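(* Let $s>1$ and $w(x)=|x-i|^{-s}$ for $x\in\mathbb{R}$. The weighted equilibrium measure $\mu_w$ for $w$ on $\mathbb{R}$ is supported on the compact interval $$S_w=\left[-\frac{\sqrt{2s-1}}{s-1},\ \frac{\sqrt{2s-1}}{s-1}\right],$$ and is given by $$d\mu_w(x)=\frac{\sqrt{2s-1-(s-1)^2x^2}}{\pi(1+x^2)}\,dx,\qquad x\in S_w.$$ Moreover, the weighted capacity is equal to $$\mathrm{cap}(\mathbb{R},w)=2^{2s-2s^2-1}\,s^{-s^2}\,(s-1)^{-(s-1)^2}\,(2s-1)^{(2s-1)^2/2}.$$
   Context: Here $i$ is the imaginary unit. Let $\mathcal{M}(\mathbb{R})$ be the set of positive unit Borel measures supported on $\mathbb{R}$. For $\mu\in\mathcal{M}(\mathbb{R})$ define the weighted energy $$I_w(\mu):=\int\!\!\int\log\frac{1}{|z-t|\,w(z)w(t)}\,d\mu(z)\,d\mu(t)=\int\!\!\int\log\frac{1}{|z-t|}\,d\mu(z)\,d\mu(t)-2\int\log w(t)\,d\mu(t),$$ and let $V_w:=\inf_{\mu\in\mathcal{M}(\mathbb{R})}I_w(\mu)$. For the present weight it is known that $V_w$ is finite and that there is a unique $\mu_w\in\mathcal{M}(\mathbb{R})$ with $I_w(\mu_w)=V_w$; this $\mu_w$ is the weighted equilibrium measure, and $S_w:=\mathrm{supp}\,\mu_w$. The weighted capacity is $\mathrm{cap}(\mathbb{R},w):=e^{-V_w}$. *)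

(* Defs.v *)
From mathcomp Require Import all_boot all_order all_algebra.
From mathcomp Require Import all_classical all_reals all_analysis.
From mathcomp Require Import complex.

Set Implicit Arguments.
Unset Strict Implicit.
Unset Printing Implicit Defensive.

Import Order.TTheory GRing.Theory Num.Theory.
Import numFieldNormedType.Exports.

Local Open Scope classical_set_scope.
Local Open Scope ring_scope.

Section WeightedEnergy.
Context {R : realType}.
Local Notation RT := (measurableTypeR R).

Definition measure_supp (mu : probability RT R) : set R :=
  [set x | forall U : set R, open U -> U x -> (0 < mu U)%E].

(* Both the inverse and the logarithm are extended-real valued, so that the
   kernel is +oo on the diagonal (0^-1 = +oo and lne +oo = +oo). *)
Definition energy_kernel (w : R -> R) (z t : R) : \bar R :=
  lne ((`|z - t| * (w z * w t))%:E^-1).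

(* When |z - t| w(z) w(t) is bounded, as for `weight s` with 1 < s, the kernel
   is bounded below, so by Tonelli this iterated integral is the integral over
   the product measure, possibly +oo. *)
Definition weighted_energy (w : R -> R) (mu : probability RT R) : \bar R :=
  (\int[mu]_z \int[mu]_t energy_kernel w z t)%E.

Definition min_energy (w : R -> R) : \bar R :=
  ereal_inf (range (weighted_energy w)).

Definition is_equilibrium_measure (w : R -> R) (mu : probability RT R) : Prop :=
  weighted_energy w mu = min_energy w.

Definition weighted_capacity (w : R -> R) : \bar R :=
  expeR (- min_energy w).

Definition weight (s : R) (x : R) : R :=
  Normc.normc (x%:C - 'i)%C `^ (- s).

End WeightedEnergy.

(* Main.v *)
Require Import Defs.
From HB Require Import structures.
From mathcomp Require Import all_boot all_order all_algebra.
From mathcomp Require Import all_classical all_reals all_analysis.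
From mathcomp Require Import measurable_realfun.
From mathcomp Require Import ring lra.

(** Write [K] for the energy kernel and [x = tan alpha]. Since
    [|z - t| = |sin (alpha - beta)| / (cos alpha cos beta)], the kernel is
    [K z t = q z + q t - ln (sin (alpha - beta) ^ 2) / 2], with the nonnegative
    field [q x = (s - 1) / 2 * ln (1 + x ^ 2)]. Up to the field this is the
    logarithmic kernel of a circle, and all the terms are nonnegative.

    Uniqueness. Put [X = cos (alpha - beta) ^ 2], so that the logarithm above is
    [- ln (1 - X) = sum_n X ^ n / n], a series of nonnegative terms valid up to
    the diagonal [X = 1] ([log_series]). As [X] is the square of an inner product
    of unit vectors, [X ^ n] is a finite sum of products, and integrating
    termwise gives an identity in [[0, +oo]] ([energy_identity]):
    [I mu mu + I nu nu = 2 I mu nu + sum_n e_n], where [e_n] is a weighted sum of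
    squares of differences of the moments of [x ^ j / (1 + x ^ 2) ^ n]. These
    moments determine a measure ([moments_determine]). So if a measure [nu] has
    [I mu nu >= I nu nu], finite, for every [mu], then it is the unique minimizer,
    and it suffices to exhibit a [nu] whose potential [int K x t dnu(t)] is a
    constant on the support of [nu] and not smaller elsewhere. The constant is
    then the minimal energy, called [robin] here.

    The candidate. With [a] the end of the interval and [b = s / (s - 1)], one has
    [b ^ 2 = 1 + a ^ 2], and the given density is [s beta - (s - 1) omega], where
    [omega] is the arcsine law of [[- a, a]] and [beta] the balayage of the point
    [i] ([ge0_integral_equilibrium], proved by comparing distribution functions).
    The map [stretch], [x |-> b x / sqrt (1 + x ^ 2)], carries [beta] to [omega],
    so both potentials are expressed by the single function
    [cheb_potential y = int_0^1 ln |y - 2 cos (pi u)| du].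

    The arcsine potential. The arcsine law of [[- 2, 2]] is invariant under
    [x |-> - x] and [x |-> x ^ 2 - 2], which gives
    [2 cheb_potential y = cheb_potential (y ^ 2 - 2)]. On [[- 2, 2]], which the
    map preserves, an integrable majorant of the logarithmic singularity shows
    the potential to be bounded, hence zero. Outside, where the map is
    [v |-> v ^ 2] for [y = v + 1 / v], it is [ln v] by the same argument applied
    to the difference.

    Conclusion. The potential of the candidate is
    [robin + (s - 1) cheb_potential (2 x / a) - s cheb_potential (2 stretch x / a)].
    On the interval both terms vanish. For [x > a], [cheb_potential (2 x / a)] is
    [artanh h] with [h = sqrt (x ^ 2 - a ^ 2) / x], and [stretch] turns [h] into
    [h / b], so with [s = (s - 1) b] the sign is that of
    [artanh h - b artanh (h / b) >= 0]. *)

Set Implicit Arguments.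
Unset Strict Implicit.
Unset Printing Implicit Defensive.

Import Order.TTheory GRing.Theory Num.Theory.
Import numFieldNormedType.Exports.

Local Open Scope classical_set_scope.
Local Open Scope ring_scope.

(** * The logarithmic series *)

Lemma is_derive_log_partial_sum (R : realType) (N : nat) (x : R) :
  is_derive x 1 (fun y : R => \sum_(n < N) y ^+ n.+1 / n.+1%:R)
    (\sum_(n < N) x ^+ n).
Proof.
elim: N => [|N IH].
  under eq_fun do rewrite big_ord0.
  by rewrite big_ord0; exact: is_derive_cst.
under eq_fun do rewrite big_ord_recr/=.
rewrite big_ord_recr/=; apply: is_deriveD.
rewrite (_ : (fun y : R => _) = N.+1%:R^-1 \*: (id ^+ N.+1 : R -> R)); last first.
  by apply/funext => y; rewrite /= mulrC exprfctE.
have := @is_deriveZ _ _ _ _ N.+1%:R^-1 x 1 _ (is_deriveX N.+1 (is_derive_id x 1)).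
rewrite (_ : _ *: _ = x ^+ N)// scaler1 -[LHS]/(_ * _).
by rewrite mulrA mulVf ?mul1r ?pnatr_eq0.
Qed.

Lemma is_derive_log1B (R : realType) (x : R) : x < 1 ->
  is_derive x 1 (fun y : R => - ln (1 - y)) (1 - x)^-1.
Proof.
move=> x1; have x1' : 0 < 1 - x by rewrite subr_gt0.
have h : is_derive (1 - x) 1 (@ln R) (1 - x)^-1 by exact: is_derive1_ln.
have h2 : is_derive x 1 (fun y : R => 1 - y) (-1).
  have := is_deriveB (is_derive_cst (1 : R) x 1) (is_derive_id x 1).
  by rewrite sub0r.
have := is_deriveN (@is_derive1_comp R (@ln R) (fun y => 1 - y) x _ _ h h2).
by rewrite mulrN1 opprK.
Qed.

(** By the mean value theorem: the derivative of the remainder is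
    [y ^ N / (1 - y)], which is monotone in [y]. *)
Lemma log1B_partial_sum (R : realType) (N : nat) (x : R) : 0 <= x < 1 ->
  0 <= - ln (1 - x) - \sum_(n < N) x ^+ n.+1 / n.+1%:R <= x ^+ N * (x / (1 - x)).
Proof.
move=> /andP[x0 x1]; have x1' : 0 < 1 - x by rewrite subr_gt0.
pose f (y : R) := - ln (1 - y) - \sum_(n < N) y ^+ n.+1 / n.+1%:R.
pose df (y : R) := y ^+ N / (1 - y).
have fdf (y : R) : y < 1 -> is_derive y 1 f (df y).
  move=> y1; have := is_deriveB (is_derive_log1B y1) (is_derive_log_partial_sum N y).
  rewrite (_ : _ - _ = df y)//.
  have y1' : 1 - y != 0 by rewrite gt_eqF// subr_gt0.
  apply: (mulfI y1'); rewrite /df mulrBr mulfV//.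
  rewrite -[(1 - y) * \sum_(_ < _) _]opprK -mulNr opprB -subrX1 mulrCA mulfV//.
  by rewrite mulr1; ring.
have [||c] := @MVT_segment R f df 0 x x0.
- by move=> y; rewrite in_itv/= => /andP[_ yx]; apply: fdf; exact: lt_trans x1.
- apply: derivable_within_continuous => y; rewrite in_itv/= => /andP[_ yx].
  by apply: ex_derive; apply: fdf; exact: le_lt_trans x1.
rewrite in_itv/= => /andP[c0 cx] E.
have f0 : f 0 = 0.
  rewrite /f subr0 ln1 oppr0 big1 ?subr0// => i _.
  by rewrite exprS mul0r mul0r.
have -> : - ln (1 - x) - \sum_(n < N) x ^+ n.+1 / n.+1%:R = df c * x.
  by rewrite -[LHS]/(f x) -[f x]subr0 -f0 E subr0.
have c1 : 0 < 1 - c by rewrite subr_gt0 (le_lt_trans cx).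
rewrite /df; apply/andP; split.
  by rewrite mulr_ge0// divr_ge0 ?exprn_ge0// ltW.
rewrite [x / _]mulrC mulrA; apply: ler_wpM2r => //.
apply: ler_pM; rewrite ?exprn_ge0 ?invr_ge0 ?(ltW c1)//.
  by rewrite lerXn2r ?nnegrE.
by rewrite lef_pV2 ?posrE// lerD2l lerN2.
Qed.

Lemma nneseries_EFin_cvg (R : realType) (u : R ^nat) (l : R) :
  (fun N => \sum_(n < N) u n) @ \oo --> l ->
  (\sum_(0 <= n <oo) (u n)%:E = l%:E)%E.
Proof.
move=> ul; apply/cvg_lim => //.
rewrite (_ : (fun n => _) = EFin \o (fun N => \sum_(n < N) u n)); last first.
  by apply/funext => N; rewrite /= sumEFin big_mkord.
exact: (cvg_comp _ _ ul).
Qed.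

Lemma log_series_lt1 (R : realType) (x : R) : 0 <= x < 1 ->
  (\sum_(0 <= n <oo) (x ^+ n.+1 / n.+1%:R)%:E = (- ln (1 - x))%:E)%E.
Proof.
move=> x01; apply: nneseries_EFin_cvg.
have /andP[x0 x1] := x01.
apply: (@squeeze_cvgr _ _ _ _ (fun N => - ln (1 - x) - x ^+ N * (x / (1 - x)))
  (fun=> - ln (1 - x))).
- near=> N; have := log1B_partial_sum N x01.
  by move=> /andP[A B]; rewrite lerBlDr -lerBlDl B -subr_ge0.
- rewrite -[X in _ --> X]subr0; apply: cvgB; first exact: cvg_cst.
  rewrite -(mul0r (x / (1 - x))); apply: cvgMl; apply: cvg_expr.
  by rewrite ger0_norm.
- exact: cvg_cst.
Unshelve. all: by end_near. Qed.

(** The logarithmic singularity as a power series with nonnegative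
    coefficients, valid up to and including the singular point [x = 1], where
    both sides are infinite: the partial sums at [1] dominate every value
    [- ln (1 - y)], [y < 1]. *)
Lemma log_series (R : realType) (x : R) : 0 <= x <= 1 ->
  (\sum_(0 <= n <oo) (x ^+ n.+1 / n.+1%:R)%:E = lne ((1 - x)%:E^-1))%E.
Proof.
move=> /andP[x0]; rewrite le_eqVlt => /predU1P[->|x1]; last first.
  have x1' : 0 < 1 - x by rewrite subr_gt0.
  rewrite log_series_lt1 ?x0// inver gt_eqF// lne_EFin ?invr_gt0//.
  by rewrite lnV ?posrE.
rewrite subrr inver eqxx; apply/eqyP => r r0.
(* the point where [- ln (1 - y)] takes the given value [r] *)
pose y : R := 1 - expR (- r).
have y01 : 0 <= y < 1.
  rewrite /y subr_ge0 -{1}expR0 ler_expR oppr_le0 (ltW r0)/= ltrBlDr ltrDl.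
  exact: expR_gt0.
have -> : r%:E = (- ln (1 - y))%:E by rewrite /y opprB addrC subrK expRK opprK.
rewrite -log_series_lt1//; apply: lee_nneseries.
  by move=> n _; rewrite lee_fin divr_ge0// exprn_ge0//; case/andP: y01.
move=> n _; rewrite lee_fin ler_wpM2r ?invr_ge0//.
by rewrite expr1n; case/andP: y01 => y0 y1; rewrite exprn_ile1// ltW.
Qed.

(** * The energy kernel on the circle *)

Definition confinement (R : realType) (s x : R) : R :=
  (s - 1) / 2 * ln (1 + x ^+ 2).

(** [cos (alpha - beta) ^ 2] for [z = tan alpha] and [t = tan beta]. *)
Definition proximity (R : realType) (z t : R) : R :=
  (1 + z * t) ^+ 2 / ((1 + z ^+ 2) * (1 + t ^+ 2)).

Lemma sqrD1_gt0 (R : realType) (x : R) : 0 < 1 + x ^+ 2.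
Proof. by rewrite ltr_pwDl ?sqr_ge0. Qed.

Lemma confinement_ge0 (R : realType) (s x : R) : 1 < s -> 0 <= confinement s x.
Proof.
move=> s1; rewrite /confinement mulr_ge0 ?divr_ge0 ?subr_ge0 ?(ltW s1)//.
by rewrite ln_ge0// lerDl sqr_ge0.
Qed.

Lemma proximity_ge0 (R : realType) (z t : R) : 0 <= proximity z t.
Proof. by rewrite divr_ge0 ?sqr_ge0// mulr_ge0 ?ltW ?sqrD1_gt0. Qed.

Lemma proximityB (R : realType) (z t : R) :
  1 - proximity z t = (z - t) ^+ 2 / ((1 + z ^+ 2) * (1 + t ^+ 2)).
Proof.
rewrite /proximity; have := sqrD1_gt0 z; have := sqrD1_gt0 t => t0 z0.
by field; rewrite !gt_eqF.
Qed.

Lemma proximity_le1 (R : realType) (z t : R) : proximity z t <= 1.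
Proof.
rewrite -subr_ge0 proximityB divr_ge0 ?sqr_ge0//.
by rewrite mulr_ge0 ?ltW ?sqrD1_gt0.
Qed.

Lemma weightE (R : realType) (s x : R) :
  weight s x = expR (- (s / 2 * ln (1 + x ^+ 2))).
Proof.
rewrite /weight /= subr0 sub0r sqrrN expr1n addrC -powR12_sqrt; last first.
  by rewrite ltW// sqrD1_gt0.
by rewrite -powRrM /powR gt_eqF ?sqrD1_gt0//; congr expR; ring.
Qed.

Lemma energy_kernel_neq (R : realType) (s z t : R) : z != t ->
  energy_kernel (weight s) z t =
  (s / 2 * ln (1 + z ^+ 2) + s / 2 * ln (1 + t ^+ 2) - ln `|z - t|)%:E.
Proof.
move=> zt; have zt0 : 0 < `|z - t| by rewrite normr_gt0 subr_eq0.
have r0 : 0 < `|z - t| * (weight s z * weight s t).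
  by rewrite mulr_gt0// !weightE mulr_gt0 ?expR_gt0.
rewrite /energy_kernel inver gt_eqF// lneV// lne_EFin// -EFinN; congr EFin.
by rewrite !weightE lnM ?posrE ?mulr_gt0 ?expR_gt0// lnM ?posrE ?expR_gt0// !expRK; ring.
Qed.

Lemma energy_kernel_diag (R : realType) (s z : R) :
  energy_kernel (weight s) z z = +oo%E.
Proof. by rewrite /energy_kernel subrr normr0 mul0r inver eqxx. Qed.

(** With [z = tan alpha] and [t = tan beta], [1 - proximity z t] is
    [sin (alpha - beta) ^ 2]: up to the external field, the kernel is the
    logarithmic kernel of a circle, and [- ln (1 - x) / 2] has a power series
    with nonnegative terms. *)
Lemma energy_kernel_series (R : realType) (s z t : R) :
  (energy_kernel (weight s) z t = (confinement s z + confinement s t)%:E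
    + \sum_(0 <= n <oo) (2^-1 * (proximity z t ^+ n.+1 / n.+1%:R))%:E)%E.
Proof.
under eq_eseriesr do rewrite EFinM.
rewrite nneseriesZl; last first.
  by move=> n _; rewrite lee_fin divr_ge0// exprn_ge0// proximity_ge0.
rewrite log_series ?proximity_ge0 ?proximity_le1// proximityB.
have [->|zt] := eqVneq z t.
  rewrite energy_kernel_diag subrr expr0n/= mul0r inver eqxx/=.
  by rewrite gt0_muley ?lte_fin// addey.
have zt0 : 0 < (z - t) ^+ 2 by rewrite exprn_even_gt0//= subr_eq0.
have z0 := sqrD1_gt0 z; have t0 := sqrD1_gt0 t.
have d0 : 0 < (z - t) ^+ 2 / ((1 + z ^+ 2) * (1 + t ^+ 2)).
  by rewrite divr_gt0// mulr_gt0.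
rewrite energy_kernel_neq// inver gt_eqF// lne_EFin ?invr_gt0//.
rewrite -EFinM -EFinD; congr EFin.
rewrite lnV ?posrE// ln_div ?posrE// ?(mulr_gt0 z0)//.
rewrite lnM ?posrE// -[(z - t) ^+ 2]real_normK ?num_real// lnXn; last first.
  by rewrite normr_gt0 subr_eq0.
by rewrite /confinement -mulr_natl; field.
Qed.

Lemma energy_kernel_ge0 (R : realType) (s z t : R) : 1 < s ->
  (0 <= energy_kernel (weight s) z t)%E.
Proof.
move=> s1; rewrite energy_kernel_series adde_ge0//.
  by rewrite lee_fin addr_ge0 ?confinement_ge0.
apply: nneseries_ge0 => n _ _.
by rewrite lee_fin mulr_ge0 ?divr_ge0 ?exprn_ge0 ?proximity_ge0.
Qed.

(** * Moments and the energy form *)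

Section moments.
Context {R : realType}.
Local Notation RT := (measurableTypeR R).
Implicit Types mu nu : probability RT R.

(** For [j <= 2 n] these functions of [x = tan alpha] are the monomials of
    degree [2 n] in [cos alpha] and [sin alpha], hence bounded by [1]. *)
Definition moment_fun (n j : nat) (x : R) : R := x ^+ j / (1 + x ^+ 2) ^+ n.

Definition moment mu (n j : nat) : R := \int[mu]_x moment_fun n j x.

Lemma measurable_inv_sqrD1 : measurable_fun [set: R] (fun x : R => (1 + x ^+ 2)^-1).
Proof.
apply: continuous_measurable_fun => x; apply: cvgV.
  by rewrite gt_eqF ?sqrD1_gt0.
by apply: cvgD; [exact: cvg_cst|exact: exprn_continuous].
Qed.

Lemma measurable_moment_fun n j : measurable_fun [set: R] (moment_fun n j).
Proof.
apply: measurable_funM; first exact: measurable_funX.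
under eq_fun do rewrite -exprVn.
by apply: measurable_funX; exact: measurable_inv_sqrD1.
Qed.

Lemma normr_moment_fun n j x : (j <= n.*2)%N -> `|moment_fun n j x| <= 1.
Proof.
move=> jn; have x0 := sqrD1_gt0 x.
rewrite /moment_fun normrM normfV [X in _ / X]ger0_norm ?exprn_ge0 ?(ltW x0)//.
rewrite ler_pdivrMr ?exprn_gt0// mul1r.
rewrite -(@ler_pXn2r _ 2) ?nnegrE ?exprn_ge0 ?(ltW x0)//.
rewrite real_normK ?num_real// [(x ^+ j) ^+ 2]exprAC -[leRHS]exprM muln2.
apply: (@le_trans _ _ ((1 + x ^+ 2) ^+ j)).
  by rewrite lerXn2r ?nnegrE ?sqr_ge0 ?(ltW x0)// lerDr.
by rewrite ler_weXn2l// lerDl sqr_ge0.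
Qed.

Lemma integrable_bounded mu (f : R -> R) (M : R) : measurable_fun [set: RT] f ->
  (forall x, `|f x| <= M) -> mu.-integrable [set: RT] (EFin \o f).
Proof.
move=> mf fM; apply: measurable_bounded_integrable => //.
  exact: (le_lt_trans (probability_le1 _ _) (ltry _)).
by exists M; split; rewrite ?num_real// => y My x _; apply: le_trans (fM x) (ltW My).
Qed.

Lemma integrable_moment_fun mu n j : (j <= n.*2)%N ->
  mu.-integrable [set: RT] (EFin \o moment_fun n j).
Proof.
move=> jn; apply: (@integrable_bounded _ _ 1); first exact: measurable_moment_fun.
by move=> x; exact: normr_moment_fun.
Qed.

Lemma integral_lincomb mu (N : nat) (c : nat -> R) (v : nat -> R -> R) :
  (forall j, (j < N)%N -> mu.-integrable [set: RT] (EFin \o v j)) ->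
  (\int[mu]_x (\sum_(j < N) c j * v j x)%:E
   = (\sum_(j < N) c j * \int[mu]_x v j x)%R%:E)%E.
Proof.
move=> iv.
have icv (j : 'I_N) : mu.-integrable [set: RT] (fun x => (c j * v j x)%:E).
  by under eq_fun do rewrite EFinM; apply: integrableZl => //; exact: iv.
under eq_integral do rewrite -sumEFin.
rewrite integral_sum// -sumEFin; apply: eq_bigr => j _.
under eq_integral do rewrite EFinM.
rewrite integralZl//; last exact: iv.
by rewrite EFinM /Rintegral fineK//; apply: integrable_fin_num => //; exact: iv.
Qed.

(** [proximity z t] is the square of the inner product of the unit vectors
    [(1, z) / sqrt (1 + z ^ 2)] and [(1, t) / sqrt (1 + t ^ 2)], so the binomial
    formula shows its powers to be positive definite kernels of finite rank. *)
Lemma proximityX n (z t : R) : proximity z t ^+ n =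
  \sum_(j < n.*2.+1) ('C(n.*2, j)%:R * moment_fun n j z) * moment_fun n j t.
Proof.
rewrite /proximity exprMn -exprM mul2n exprDn mulr_suml; apply: eq_bigr => j _.
rewrite expr1n mul1r exprVn !exprMn /moment_fun -mulr_natr.
have z0 := sqrD1_gt0 z; have t0 := sqrD1_gt0 t.
by field; rewrite !expf_neq0 ?gt_eqF.
Qed.

Lemma integral_proximityX mu n (z : R) : (\int[mu]_t (proximity z t ^+ n)%:E
  = (\sum_(j < n.*2.+1) 'C(n.*2, j)%:R * moment mu n j * moment_fun n j z)%R%:E)%E.
Proof.
under eq_integral do rewrite proximityX.
rewrite (@integral_lincomb _ _ (fun j => 'C(n.*2, j)%:R * moment_fun n j z)); last first.
  by move=> j jn; exact: integrable_moment_fun.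
by congr EFin; apply: eq_bigr => j _; rewrite mulrAC.
Qed.

Definition moment_form mu nu n : R :=
  \sum_(j < n.*2.+1) 'C(n.*2, j)%:R * moment nu n j * moment mu n j.

Lemma moment_formE mu nu n :
  (\int[mu]_z \int[nu]_t (proximity z t ^+ n)%:E = (moment_form mu nu n)%:E)%E.
Proof.
under eq_integral do rewrite integral_proximityX.
rewrite (@integral_lincomb _ _ (fun j => 'C(n.*2, j)%:R * moment nu n j))// => j jn.
exact: integrable_moment_fun.
Qed.

Lemma moment_form_ge0 mu nu n : 0 <= moment_form mu nu n.
Proof.
rewrite -lee_fin -moment_formE; apply: integral_ge0 => z _.
by apply: integral_ge0 => t _; rewrite lee_fin exprn_ge0// proximity_ge0.
Qed.

Lemma moment_formC mu nu n : moment_form mu nu n = moment_form nu mu n.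
Proof. by apply: eq_bigr => j _; rewrite mulrAC. Qed.

Definition moment_dist mu nu n : R :=
  \sum_(j < n.*2.+1) 'C(n.*2, j)%:R * (moment mu n j - moment nu n j) ^+ 2.

Lemma moment_dist_ge0 mu nu n : 0 <= moment_dist mu nu n.
Proof. by apply: sumr_ge0 => j _; rewrite mulr_ge0 ?sqr_ge0. Qed.

Lemma moment_formDdist mu nu n : moment_form mu mu n + moment_form nu nu n =
  moment_form mu nu n + moment_form nu mu n + moment_dist mu nu n.
Proof.
rewrite /moment_form /moment_dist -!big_split/=; apply: eq_bigr => j _; ring.
Qed.

Lemma moment_dist_eq0 mu nu n j : (j <= n.*2)%N -> moment_dist mu nu n = 0 ->
  moment mu n j = moment nu n j.
Proof.
move=> jn /eqP; rewrite psumr_eq0; last first.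
  by move=> i _; rewrite mulr_ge0 ?sqr_ge0.
move=> /allP/(_ (Ordinal (jn : (j < n.*2.+1)%N))); rewrite mem_index_enum => /(_ isT).
rewrite /= mulf_eq0 pnatr_eq0 gtn_eqF ?bin_gt0//= sqrf_eq0 subr_eq0.
by move/eqP.
Qed.

End moments.

Section energy.
Context {R : realType}.
Local Notation RT := (measurableTypeR R).
Context (s : R) (s1 : 1 < s).
Implicit Types mu nu : probability RT R.
Local Open Scope ereal_scope.

Definition mutual_energy mu nu : \bar R :=
  \int[mu]_z \int[nu]_t energy_kernel (weight s) z t.

Lemma measurable_confinement : measurable_fun [set: RT] (confinement s).
Proof.
apply: measurable_funM => //; apply: measurableT_comp; first exact: measurable_ln.
by apply: measurable_funD => //; exact: measurable_funX.
Qed.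

Lemma measurable_proximityX n (z : R) :
  measurable_fun [set: RT] (fun t => (proximity z t ^+ n)%R).
Proof.
under eq_fun do rewrite proximityX.
apply: measurable_sum => j; apply: measurable_funM => //.
exact: measurable_moment_fun.
Qed.

Lemma integral_energy_kernel nu (z : R) :
  \int[nu]_t energy_kernel (weight s) z t =
  (confinement s z)%:E + \int[nu]_t (confinement s t)%:E +
  \sum_(0 <= n <oo) (2^-1 / n.+1%:R *
    \sum_(j < n.+1.*2.+1) 'C(n.+1.*2, j)%:R * moment nu n.+1 j * moment_fun n.+1 j z)%R%:E.
Proof.
have q0 t : 0 <= (confinement s t)%:E by rewrite lee_fin confinement_ge0.
have mq : measurable_fun [set: RT] (fun t => (confinement s t)%:E).
  by apply/measurable_EFinP; exact: measurable_confinement.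
have mX n : measurable_fun [set: RT]
    (fun t => (2^-1 * (proximity z t ^+ n.+1 / n.+1%:R))%R%:E).
  apply/measurable_EFinP/measurable_funM => //; apply: measurable_funM => //.
  exact: measurable_proximityX.
have X0 n t : 0 <= (2^-1 * (proximity z t ^+ n.+1 / n.+1%:R))%R%:E.
  by rewrite lee_fin mulr_ge0 ?divr_ge0 ?exprn_ge0 ?proximity_ge0.
under eq_integral do rewrite energy_kernel_series EFinD.
rewrite ge0_integralD//; last 4 first.
- by move=> t _; rewrite adde_ge0.
- by apply: emeasurable_funD => //; exact: measurable_cst.
- by move=> t _; exact: nneseries_ge0.
- by apply: ge0_emeasurable_sum.
rewrite ge0_integralD//.
rewrite integral_cst// [X in _ * X]probability_setT mule1; congr (_ + _).
rewrite integral_nneseries//; apply: eq_eseriesr => n _.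
under eq_integral do rewrite mulrCA mulrC EFinM.
rewrite ge0_integralZl//; last 2 first.
- by apply/measurable_EFinP; exact: measurable_proximityX.
- by move=> t _; rewrite lee_fin exprn_ge0// proximity_ge0.
by rewrite integral_proximityX -EFinM.
Qed.

(** Integrating the series termwise makes the logarithmic part of the mutual
    energy a diagonal bilinear form in the moments of the two measures. *)
Lemma mutual_energyE mu nu : mutual_energy mu nu =
  \int[mu]_t (confinement s t)%:E + \int[nu]_t (confinement s t)%:E +
  \sum_(0 <= n <oo) (2^-1 / n.+1%:R * moment_form mu nu n.+1)%R%:E.
Proof.
have q0 t : 0 <= (confinement s t)%:E by rewrite lee_fin confinement_ge0.
have mq : measurable_fun [set: RT] (fun t => (confinement s t)%:E).
  by apply/measurable_EFinP; exact: measurable_confinement.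
have Q0 : 0 <= \int[nu]_t (confinement s t)%:E by apply: integral_ge0.
have S0 n (z : R) : (0 <= (2^-1 / n.+1%:R * \sum_(j < n.+1.*2.+1)
    'C(n.+1.*2, j)%:R * moment nu n.+1 j * moment_fun n.+1 j z))%R.
  rewrite mulr_ge0 ?divr_ge0// -lee_fin -integral_proximityX.
  by apply: integral_ge0 => t _; rewrite lee_fin exprn_ge0// proximity_ge0.
have mS n : measurable_fun [set: RT] (fun z => \sum_(j < n.+1.*2.+1)
    'C(n.+1.*2, j)%:R * moment nu n.+1 j * moment_fun n.+1 j z)%R.
  by apply: measurable_sum => j; apply: measurable_funM => //; exact: measurable_moment_fun.
have mS' n : measurable_fun [set: RT] (fun z => (2^-1 / n.+1%:R * \sum_(j < n.+1.*2.+1)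
    'C(n.+1.*2, j)%:R * moment nu n.+1 j * moment_fun n.+1 j z)%R%:E).
  by apply/measurable_EFinP/measurable_funM.
rewrite /mutual_energy; under eq_integral do rewrite integral_energy_kernel.
rewrite ge0_integralD//; last 4 first.
- by move=> t _; rewrite adde_ge0.
- by apply: emeasurable_funD => //; exact: measurable_cst.
- by move=> t _; apply: nneseries_ge0 => n _ _; rewrite lee_fin.
- by apply: ge0_emeasurable_sum => // n t _ _; rewrite lee_fin.
rewrite ge0_integralD//.
rewrite integral_cst// [X in _ * X]probability_setT mule1; congr (_ + _).
rewrite integral_nneseries//; last by move=> n t _; rewrite lee_fin.
apply: eq_eseriesr => n _.
under eq_integral do rewrite EFinM.
rewrite ge0_integralZl//; last 2 first.
- exact/measurable_EFinP.
- move=> z _; rewrite -integral_proximityX.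
  by apply: integral_ge0 => t _; rewrite lee_fin exprn_ge0// proximity_ge0.
rewrite (@integral_lincomb _ _ _ (fun j => 'C(n.+1.*2, j)%:R * moment nu n.+1 j)%R)//.
move=> j jn; exact: integrable_moment_fun.
Qed.

Lemma mutual_energyC mu nu : mutual_energy mu nu = mutual_energy nu mu.
Proof.
rewrite !mutual_energyE [X in X + _]addeC; congr (_ + _).
by apply: eq_eseriesr => n _; rewrite moment_formC.
Qed.

(** Positive definiteness of the energy with an explicit remainder: the fields
    contribute equally to both sides, and the rest is a diagonal quadratic form
    in the moments. Every term is nonnegative, so infinite energies are allowed. *)
Lemma energy_identity mu nu :
  mutual_energy mu mu + mutual_energy nu nu =
  mutual_energy mu nu + mutual_energy mu nu +
  \sum_(0 <= n <oo) (2^-1 / n.+1%:R * moment_dist mu nu n.+1)%R%:E.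
Proof.
have F0 mu' nu' n : 0 <= (2^-1 / n.+1%:R * moment_form mu' nu' n.+1)%R%:E.
  by rewrite lee_fin mulr_ge0 ?moment_form_ge0 ?divr_ge0.
rewrite [X in _ = _ + X + _]mutual_energyC !mutual_energyE.
set p := \int[mu]_t _; set q := \int[nu]_t _.
rewrite [LHS]addeACA -nneseriesD// [X in _ = X + _]addeACA -nneseriesD//.
rewrite -[RHS]addeA -nneseriesD; last 2 first.
- by move=> n _ _; exact: adde_ge0.
- by move=> n _ _; rewrite lee_fin mulr_ge0 ?moment_dist_ge0 ?divr_ge0.
rewrite [X in X + _ = _]addeACA [q + p]addeC; congr (_ + _).
by apply: eq_eseriesr => n _; rewrite -!EFinD -!mulrDr moment_formDdist.
Qed.

End energy.

(** * Measures are determined by their moments *)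

Lemma bernoulli_ineq (R : realType) (N : nat) (y : R) : 0 <= y <= 1 ->
  1 - N%:R * y <= (1 - y) ^+ N.
Proof.
move=> /andP[y0 y1]; elim: N => [|N IH]; first by rewrite mul0r subr0 expr0.
rewrite exprS; apply: (@le_trans _ _ ((1 - y) * (1 - N%:R * y))); last first.
  by rewrite ler_wpM2l// subr_ge0.
rewrite -subr_ge0 -natr1.
have -> : (1 - y) * (1 - N%:R * y) - (1 - (N%:R + 1) * y) = N%:R * y ^+ 2 by ring.
by rewrite mulr_ge0// sqr_ge0.
Qed.

(** With [p = (1 + r) / 2], [r <= p ^ 2], while [n p ^ n] stays below the sum of
    the geometric series of ratio [p]. *)
Lemma cvg_natrMexpr (R : realType) (r : R) : 0 <= r < 1 ->
  (fun n : nat => n%:R * r ^+ n) @ \oo --> 0.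
Proof.
move=> /andP[r0 r1]; pose p := (1 + r) / 2.
have p0 : 0 < p by rewrite /p divr_gt0// ltr_pwDl.
have p1 : p < 1 by rewrite /p; lra.
have rp : r <= p ^+ 2.
  rewrite -subr_ge0; have -> : p ^+ 2 - r = ((1 - r) / 2) ^+ 2 by rewrite /p; field.
  exact: sqr_ge0.
have np n : n%:R * p ^+ n <= (1 - p)^-1.
  rewrite -[leRHS]mul1r ler_pdivlMr ?subr_gt0//.
  have : \sum_(k < n) p ^+ n <= \sum_(k < n) p ^+ k.
    by apply: ler_sum => k _; rewrite ler_wiXn2l ?(ltW p0) ?(ltW p1)// ltnW.
  rewrite sumr_const card_ord => h; rewrite mulr_natl.
  apply: (@le_trans _ _ ((\sum_(k < n) p ^+ k) * (1 - p))).
    by rewrite ler_wpM2r// subr_ge0 ltW.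
  rewrite mulrC -opprB mulNr -subrX1 opprB lerBlDr lerDl.
  by rewrite exprn_ge0// ltW.
apply: (@squeeze_cvgr _ _ _ _ (fun=> 0) (fun n => (1 - p)^-1 * p ^+ n)).
- near=> n; rewrite mulr_ge0 ?exprn_ge0//=.
  apply: (@le_trans _ _ ((n%:R * p ^+ n) * p ^+ n)); last first.
    by rewrite ler_wpM2r// exprn_ge0// ltW.
  rewrite -mulrA ler_wpM2l// -exprD addnn -mul2n exprM.
  by apply: lerXn2r => //; rewrite nnegrE ?sqr_ge0.
- exact: cvg_cst.
- rewrite -(mulr0 (1 - p)^-1); apply: cvgMr; apply: cvg_expr.
  by rewrite ger0_norm ?ltW.
Unshelve. all: by end_near. Qed.

(** Polynomials on [[0, 1]] converging boundedly to the indicator function of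
    [[0, 1/2[]. The factor [n] in the exponent forces the limit to be [0], and
    not [exp (- 1)], at the threshold. *)
Lemma cvg_threshold (R : realType) (t : R) : 0 <= t <= 1 ->
  (fun n : nat => (1 - t ^+ n) ^+ (n * 2 ^ n)) @ \oo --> ((t < 2^-1)%R%:R : R).
Proof.
move=> /andP[t0 t1].
have tn n : 0 <= t ^+ n <= 1 by rewrite exprn_ge0//= exprn_ile1.
have tn1 n : 0 <= 1 - t ^+ n by rewrite subr_ge0; case/andP: (tn n).
have [t2|t2] := ltP t 2^-1.
  apply: (@squeeze_cvgr _ _ _ _ (fun n => 1 - n%:R * (2 * t) ^+ n) (fun=> 1)).
  - near=> n; apply/andP; split.
      apply: le_trans (bernoulli_ineq _ (tn n)).
      by rewrite exprMn natrM natrX mulrA.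
    by rewrite exprn_ile1// lerBlDr lerDl; case/andP: (tn n).
  - rewrite -[X in _ --> X]subr0; apply: cvgB; first exact: cvg_cst.
    apply: cvg_natrMexpr; rewrite mulr_ge0//=; lra.
  - exact: cvg_cst.
apply: (@squeeze_cvgr _ _ _ _ (fun=> 0) (fun n => expR (- 1) ^+ n)).
- near=> n; rewrite exprn_ge0//=.
  apply: (@le_trans _ _ (expR (- t ^+ n) ^+ (n * 2 ^ n))).
    rewrite lerXn2r ?nnegrE ?expR_ge0//.
    by apply: le_trans (expR_ge1Dx _).
  rewrite -!expRM_natl ler_expR natrM natrX mulrN mulrN1 lerN2 -mulrA -exprMn.
  by rewrite ler_peMr// exprn_ege1//; lra.
- exact: cvg_cst.
- by apply: cvg_expr; rewrite ger0_norm ?expR_ge0// -expR0 ltr_expR ltrN10.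
Unshelve. all: by end_near. Qed.

Section determinacy.
Context {R : realType}.
Local Notation RT := (measurableTypeR R).
Implicit Types mu nu : probability RT R.

Lemma eq_measure_rays (m1 m2 : {measure set RT -> \bar R}) :
  (forall c, m1 `]-oo, c[%classic = m2 `]-oo, c[%classic) ->
  (forall c, (m1 `]-oo, c[%classic < +oo)%E) ->
  forall A : set RT, measurable A -> m1 A = m2 A.
Proof.
move=> m12 m1oo A; rewrite [X in X A -> _]RGenInftyO.measurableE => mA.
refine (@g_sigma_algebra_measure_unique _ R RT (@RGenInftyO.G R) _
  (fun n => `]-oo, n%:R[%classic) _ _ m1 m2 _ _ _ A _) => //.
- by move=> _ [x ->]; exact: measurable_itv.
- by move=> n; exists n%:R.
- rewrite -subTset => x _; exists (Num.truncn `|x|).+1 => //=.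
  by rewrite in_itv/=; apply: le_lt_trans (ler_norm _) (truncnS_gt _).
- move=> _ _ [x ->] [y ->]; exists (Num.min x y).
  apply/seteqP; split => z /=; rewrite !in_itv/= lt_min.
    by move=> [-> ->].
  by move=> /andP.
- by move=> _ [x ->]; exact: m12.
Qed.

Lemma eq_probability_rays mu nu :
  (forall c, mu `]-oo, c[%classic = nu `]-oo, c[%classic) ->
  forall A : set RT, measurable A -> mu A = nu A.
Proof.
move=> munu; apply: eq_measure_rays => // c.
by apply: le_lt_trans (probability_le1 _ _) (ltry _); exact: measurable_itv.
Qed.

(** The numerator of [threshold_fun]; the factor [k] keeps the deviation of
    [threshold_fun] from [1/2] at most [1/2]. *)
Definition threshold_poly (c : R) : {poly R} :=
  let k := (2 * (1 + `|c|))^-1 in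
  2^-1 *: (1 + 'X^2) + k *: ('X - c%:P).

Definition threshold_fun (c x : R) : R := (threshold_poly c).[x] / (1 + x ^+ 2).

Lemma threshold_funE c x :
  threshold_fun c x = 2^-1 + (x - c) / (2 * (1 + `|c|) * (1 + x ^+ 2)).
Proof.
rewrite /threshold_fun /threshold_poly !hornerE.
have x0 := sqrD1_gt0 x.
have c0 : 0 < 1 + `|c| by rewrite ltr_pwDl.
by field; rewrite !gt_eqF.
Qed.

Lemma threshold_fun01 c x : 0 <= threshold_fun c x <= 1.
Proof.
rewrite threshold_funE; have x0 := sqrD1_gt0 x.
have c0 : 0 < 1 + `|c| by rewrite ltr_pwDl.
have d0 : 0 < 2 * (1 + `|c|) * (1 + x ^+ 2) by rewrite !mulr_gt0.
suff : `|(x - c) / (2 * (1 + `|c|) * (1 + x ^+ 2))| <= 2^-1.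
  by rewrite ler_norml => /andP[A B]; apply/andP; split; lra.
rewrite normrM normfV [X in _ / X]gtr0_norm// ler_pdivrMr// -!mulrA mulKf//.
apply: le_trans (ler_normB _ _) _.
have h : `|x| <= 1 + x ^+ 2.
  rewrite -[x ^+ 2]real_normK ?num_real// -subr_ge0.
  have -> : 1 + `|x| ^+ 2 - `|x| = (`|x| - 2^-1) ^+ 2 + 3 / 4 by field.
  by rewrite addr_ge0 ?sqr_ge0.
have : 0 <= `|c| * x ^+ 2 by rewrite mulr_ge0 ?sqr_ge0.
lra.
Qed.

Lemma threshold_fun_lt c x : (threshold_fun c x < 2^-1) = (x < c).
Proof.
rewrite threshold_funE -ltrBrDl subrr.
have d0 : 0 < 2 * (1 + `|c|) * (1 + x ^+ 2).
  by rewrite !mulr_gt0 ?sqrD1_gt0// ltr_pwDl.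
by rewrite pmulr_llt0 ?invr_gt0// subr_lt0.
Qed.

Lemma threshold_funX c m x : threshold_fun c x ^+ m =
  \sum_(j < m.*2.+1) (threshold_poly c ^+ m)`_j * moment_fun m j x.
Proof.
rewrite /threshold_fun exprMn exprVn -horner_exp.
rewrite (@horner_coef_wide _ m.*2.+1) ?mulr_suml; last first.
  apply: leq_trans (size_poly_exp_leq _ _) _.
  rewrite ltnS -mul2n leq_mul2r; apply/orP; right.
  rewrite -subn1 leq_subLR /threshold_poly.
  apply: leq_trans (size_polyD _ _) _; rewrite geq_max.
  apply/andP; split; apply: leq_trans (size_scale_leq _ _) _.
    apply: leq_trans (size_polyD _ _) _.
    by rewrite size_poly1 size_polyXn.
  by rewrite size_XsubC.
by apply: eq_bigr => j _; rewrite mulrA.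
Qed.

Lemma measurable_threshold_fun c : measurable_fun [set: R] (threshold_fun c).
Proof.
rewrite (_ : threshold_fun c = fun x => threshold_fun c x ^+ 1); last first.
  by apply/funext => x; rewrite expr1.
under eq_fun do rewrite threshold_funX.
apply: measurable_sum => j; apply: measurable_funM => //.
exact: measurable_moment_fun.
Qed.

Lemma normr_threshold_funX c m x : `|threshold_fun c x ^+ m| <= 1.
Proof.
have /andP[h0 h1] := threshold_fun01 c x.
by rewrite ger0_norm ?exprn_ge0// exprn_ile1.
Qed.

Lemma moment00 mu : moment mu 0 0 = 1.
Proof.
rewrite /moment (eq_Rintegral _ (g := cst 1)) => [|x _].
  by rewrite Rintegral_cst// [X in fine X]probability_setT mulr1.
by rewrite /moment_fun !expr0 divr1.
Qed.

Lemma integral_threshold_poly mu c (Q : {poly R}) :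
  (\int[mu]_x (Q.[threshold_fun c x])%:E = (\sum_(i < size Q) Q`_i *
    \sum_(j < i.*2.+1) (threshold_poly c ^+ i)`_j * moment mu i j)%R%:E)%E.
Proof.
under eq_integral do rewrite horner_coef.
rewrite (@integral_lincomb _ _ _ (fun i => Q`_i) (fun i x => threshold_fun c x ^+ i)); last first.
  move=> i _; apply: (@integrable_bounded _ _ _ 1).
    by apply: measurable_funX; exact: measurable_threshold_fun.
  by move=> x; exact: normr_threshold_funX.
congr EFin; apply: eq_bigr => i _; congr (_ * _).
rewrite /Rintegral; under eq_integral do rewrite threshold_funX.
rewrite (@integral_lincomb _ _ _ (fun j => (threshold_poly c ^+ i)`_j))//.
by move=> j jn; exact: integrable_moment_fun.
Qed.

(** The moments of [x ^ j / (1 + x ^ 2) ^ n] are the trigonometric moments of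
    the image of the measure under [x = tan a]. They determine the mass of a
    ray [x < c]: on it [threshold_fun c] is below [1/2], and polynomials in
    [threshold_fun c] converge to its indicator function. *)
Lemma moments_determine mu nu :
  (forall n j, (j <= n.+1.*2)%N -> moment mu n.+1 j = moment nu n.+1 j) ->
  forall A : set RT, measurable A -> mu A = nu A.
Proof.
move=> Hm; apply: eq_probability_rays => c.
pose Q (n : nat) : {poly R} := (1 - 'X^n) ^+ (n * 2 ^ n).
have QE n x : (Q n).[threshold_fun c x] = (1 - threshold_fun c x ^+ n) ^+ (n * 2 ^ n).
  by rewrite /Q horner_exp !hornerE.
have cvgQ (P : probability RT R) : (\int[P]_x (Q n).[threshold_fun c x]%:E)%E @[n --> \oo]
    --> P `]-oo, c[%classic.
  have -> : P `]-oo, c[%classic = (\int[P]_x (\1_(`]-oo, c[%classic : set RT) x)%:E)%E.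
    by rewrite integral_indic// setIT.
  apply: (@dominated_cvg _ _ _ _ _ _ _ _ (cst 1%E)) => //.
  - move=> n; apply/measurable_EFinP; under eq_fun do rewrite QE.
    apply: measurable_funX; apply: measurable_funB => //.
    by apply: measurable_funX; exact: measurable_threshold_fun.
  - move=> x _; under eq_fun do rewrite QE.
    apply: cvg_EFin; first by near=> n.
    rewrite indicE mem_setE in_itv/= -threshold_fun_lt.
    exact: cvg_threshold (threshold_fun01 c x).
  - exact: finite_measure_integrable_cst.
  - move=> n x _; rewrite QE lee_fin.
    have /andP[h0 h1] := threshold_fun01 c x.
    have h : 0 <= 1 - threshold_fun c x ^+ n by rewrite subr_ge0 exprn_ile1.
    by rewrite ger0_norm ?exprn_ge0// exprn_ile1// lerBlDr lerDl exprn_ge0.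
suff E : (fun n => \int[mu]_x (Q n).[threshold_fun c x]%:E)%E =
    (fun n => \int[nu]_x (Q n).[threshold_fun c x]%:E)%E.
  by apply: (cvg_unique _ (cvgQ mu)) => //; rewrite E; exact: cvgQ.
apply/funext => n; rewrite !integral_threshold_poly; congr EFin.
apply: eq_bigr => -[[|i] ilt] _ /=; congr (_ * _).
  by rewrite !big_ord1 !moment00.
apply: eq_bigr => j _; congr (_ * _); apply: Hm.
by rewrite -ltnS.
Unshelve. all: by end_near. Qed.

End determinacy.

(** * Images of the uniform law *)

Section transfer.
Context {R : realType}.
Local Notation RT := (measurableTypeR R).
Implicit Types P Q : probability RT R.

Definition mfun_pack (phi : RT -> RT) (mphi : measurable_fun [set: RT] phi) :
  {mfun RT >-> RT} := HB.pack phi (isMeasurableFun.Build _ _ _ _ phi mphi).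

Definition transports (phi : RT -> RT) P Q :=
  measurable_fun [set: RT] phi /\
  forall A : set RT, measurable A -> P (phi @^-1` A) = Q A.

Lemma transports_rays (phi : RT -> RT) P Q : measurable_fun [set: RT] phi ->
  (forall c, P [set u | phi u < c] = Q `]-oo, c[%classic) -> transports phi P Q.
Proof.
move=> mphi H; split => //.
pose D : probability RT R := distribution P (mfun_pack mphi).
apply: (@eq_probability_rays _ D Q) => c; rewrite -H.
by congr (P _); apply/seteqP; split => u; rewrite /= in_itv.
Qed.

Lemma ge0_integral_transport (phi : RT -> RT) P Q (f : RT -> \bar R) :
  transports phi P Q -> measurable_fun [set: RT] f -> (forall x, 0 <= f x)%E ->
  (\int[Q]_x f x = \int[P]_u f (phi u))%E.
Proof.
move=> [mphi H] mf f0.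
pose D : probability RT R := distribution P (mfun_pack mphi).
rewrite (@eq_measure_integral _ _ _ _ D); last by move=> A mA _; exact/esym/H.
by rewrite ge0_integral_distribution.
Qed.

Lemma integrable_transport (phi : RT -> RT) P Q (f : RT -> R) :
  transports phi P Q -> Q.-integrable [set: RT] (EFin \o f) ->
  P.-integrable [set: RT] (EFin \o (f \o phi)).
Proof.
move=> tr /integrableP[mf foo]; have [mphi _] := tr.
apply/integrableP; split; first exact: (measurableT_comp mf mphi).
rewrite -(@ge0_integral_transport phi P Q (fun x => `|(f x)%:E|%E))//.
exact: measurableT_comp.
Qed.

Lemma integral_transport (phi : RT -> RT) P Q (f : RT -> R) :
  transports phi P Q -> Q.-integrable [set: RT] (EFin \o f) ->
  \int[Q]_x f x = \int[P]_u f (phi u).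
Proof.
move=> tr fi; have [mphi H] := tr.
have fi' := integrable_transport tr fi.
pose D : probability RT R := distribution P (mfun_pack mphi).
rewrite /Rintegral (@eq_measure_integral _ _ _ _ D); last by move=> A mA _; exact/esym/H.
rewrite integral_distribution//.
by have /integrableP[] := fi.
Qed.

Lemma Rintegral_ae P (N : set RT) (f g : RT -> R) : measurable N -> P N = 0%E ->
  measurable_fun [set: RT] f -> measurable_fun [set: RT] g ->
  (forall x, ~ N x -> f x = g x) -> \int[P]_x f x = \int[P]_x g x.
Proof.
move=> mN PN mf mg fg; rewrite /Rintegral; congr fine; apply: ae_eq_integral => //.
- exact/measurable_EFinP.
- exact/measurable_EFinP.
- exists N; split => // x /= nfg; apply: contrapT => /fg h.
  by apply: nfg => _; rewrite h.
Qed.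

End transfer.

Section uniform.
Context {R : realType}.
Local Notation RT := (measurableTypeR R).

Definition unif : probability RT R := uniform_prob (@ltr01 R).

Lemma unifE (A : set RT) : measurable A ->
  unif A = lebesgue_measure (A `&` `[0, 1]%classic).
Proof.
move=> mA; rewrite [LHS]integral_uniform_pdf.
rewrite (eq_integral (cst 1%E)) => [|x].
  by rewrite integral_cst ?mul1e//; exact: measurableI.
by rewrite inE/= in_itv/= => -[_ x01]; rewrite /uniform_pdf x01 subr0 invr1.
Qed.

Lemma unif_itvcc (x y : R) : 0 <= x -> x <= y -> y <= 1 ->
  unif `[x, y]%classic = (y - x)%:E.
Proof.
move=> x0 xy y1; rewrite unifE ?measurable_itv// setIidl; last first.
  move=> z /=; rewrite !in_itv/= => /andP[xz zy].
  by rewrite (le_trans x0 xz) (le_trans zy y1).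
rewrite lebesgue_measure_itv/= lte_fin; case: ltP => // yx.
by rewrite (@le_anti _ _ x y) ?subrr// xy.
Qed.

Lemma unif_outside (A : set RT) : measurable A -> A `&` `[0, 1]%classic = set0 ->
  unif A = 0%E.
Proof. by move=> mA A0; rewrite unifE// A0 measure0. Qed.

Lemma eq_unif (A B : set RT) : measurable A -> measurable B ->
  (forall u, 0 <= u <= 1 -> A u <-> B u) -> unif A = unif B.
Proof.
move=> mA mB AB; rewrite !unifE//; congr lebesgue_measure.
by apply/seteqP; split => u [] /[swap]; rewrite /= in_itv/= => u01 /(AB _ u01).
Qed.

(** The preimage of a ray under each of the maps below is the complement in
    [[0, 1]] of an interval. *)
Lemma unif_setC_itv (A : set RT) (x y : R) : measurable A -> 0 <= x -> x <= y -> y <= 1 ->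
  (forall u, 0 <= u <= 1 -> A u <-> ~ (x <= u <= y)) -> unif A = (1 - (y - x))%:E.
Proof.
move=> mA x0 xy y1 AC; rewrite (@eq_unif A (~` `[x, y]%classic))//.
- by rewrite probability_setC ?measurable_itv// unif_itvcc// -EFinB.
- by apply: measurableC; exact: measurable_itv.
Qed.

Lemma unif_ray (c : R) : 0 <= c <= 1 -> unif `]-oo, c[%classic = c%:E.
Proof.
move=> /andP[c0 c1]; rewrite (@unif_setC_itv _ c 1)//; first by congr EFin; ring.
move=> u /andP[_ u1] /=; rewrite in_itv/= u1 andbT ltNge.
by split => [/negP|/negP].
Qed.

Lemma unif_null (A : set RT) (v : R) : measurable A ->
  (forall u, 0 <= u <= 1 -> A u -> u = v) -> unif A = 0%E.
Proof.
move=> mA Av; rewrite unifE//; apply/eqP; rewrite -measure_le0.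
apply: (@le_trans _ _ (lebesgue_measure [set v])).
  apply: le_measure; rewrite ?inE//; first exact: measurableI.
  by move=> u [Au]; rewrite /= in_itv/= => u01; exact: Av.
by rewrite lebesgue_measure_set1.
Qed.

(** The Chebyshev map [x -> x ^ 2 - 2] in the coordinate [x = 2 cos (pi u)]. *)
Definition tent (u : R) : R := 1 - `|1 - 2 * u|.

Lemma measurable_tent : measurable_fun [set: RT] tent.
Proof.
apply: measurable_funB => //; apply: measurableT_comp => //.
by apply: measurable_funB => //; exact: measurable_funM.
Qed.

Lemma measurable_lt (phi : RT -> RT) (c : R) : measurable_fun [set: RT] phi ->
  measurable ([set u | phi u < c] : set RT).
Proof.
move=> mphi; rewrite -[X in measurable X]setTI.
rewrite (_ : [set u | _] = phi @^-1` `]-oo, c[%classic).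
  by apply: mphi => //; exact: measurable_itv.
by apply/seteqP; split => u /=; rewrite in_itv.
Qed.

Lemma transports_unif (phi : RT -> RT) : measurable_fun [set: RT] phi ->
  (forall u, 0 <= u <= 1 -> 0 <= phi u <= 1) ->
  (forall c, 0 <= c <= 1 -> unif [set u | phi u < c] = c%:E) ->
  transports phi unif unif.
Proof.
move=> mphi phi01 H; apply: transports_rays => // c.
have mA := measurable_lt c mphi.
have [c0|c0] := leP 0 c; last first.
  rewrite !unif_outside//; apply/seteqP; split => u //= [].
    rewrite !in_itv/= => uc /andP[u0 _].
    by have := lt_trans (le_lt_trans u0 uc) c0; rewrite ltxx.
  rewrite in_itv/= => uc /phi01/andP[p0 _].
  by have := lt_trans (le_lt_trans p0 uc) c0; rewrite ltxx.
have [c1|c1] := leP c 1; first by rewrite H ?unif_ray ?c0.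
apply: eq_unif => //; move=> u u01 /=; rewrite in_itv/=.
have /andP[_ p1] := phi01 u u01; have /andP[_ u1] := u01.
by split => _; [exact: le_lt_trans u1 c1|exact: le_lt_trans p1 c1].
Qed.

Lemma transports_tent : transports tent unif unif.
Proof.
apply: transports_unif; first exact: measurable_tent.
  move=> u /andP[u0 u1]; rewrite /tent subr_ge0 lerBlDr lerDl normr_ge0 andbT.
  by rewrite ler_norml; apply/andP; split; lra.
move=> c /andP[c0 c1]; rewrite (@unif_setC_itv _ (c / 2) (1 - c / 2)); last 5 first.
- by apply: measurable_lt; exact: measurable_tent.
- lra.
- lra.
- lra.
- move=> u u01 /=; rewrite /tent ltrBlDr -ltrBlDl ltNge ler_norml.
  have -> : (- (1 - c) <= 1 - 2 * u <= 1 - c) = (c / 2 <= u <= 1 - c / 2).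
    by apply/idP/idP => /andP[h1 h2]; apply/andP; split; lra.
  by split => [/negP|/negP].
by congr EFin; field.
Qed.

Lemma transports_flip : transports (fun u => 1 - u) unif unif.
Proof.
apply: transports_unif; first exact: measurable_funB.
  by move=> u /andP[u0 u1]; apply/andP; split; lra.
move=> c /andP[c0 c1]; rewrite (@unif_setC_itv _ 0 (1 - c)); last 5 first.
- by apply: measurable_lt; exact: measurable_funB.
- lra.
- lra.
- lra.
- move=> u /andP[u0 u1] /=; rewrite u0/= ltNge.
  have -> : (c <= 1 - u) = (u <= 1 - c) by apply/idP/idP => h; lra.
  by split => [/negP|/negP].
by congr EFin; ring.
Qed.

End uniform.

(** * The logarithmic singularity of the arcsine law *)

Section cosine_separation.
Context {R : realType}.

(** [sin x = 2 sin y cos y >= 2 y cos y ^ 2 = y (1 + cos x)] with [y = x / 2]. *)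
Lemma ler_sin_half (x : R) : 0 <= x <= pi / 2 -> x / 2 <= sin x.
Proof.
move=> /andP[x0 xpi]; pose y := x / 2.
have pi0 := pi_gt0 R.
have y0 : 0 <= y by rewrite /y; lra.
have [|c] := @MVT_segment R sin cos 0 y y0.
  by apply: derivable_within_continuous => z _.
rewrite in_itv/= => /andP[c0 cy]; rewrite sin0 !subr0 => siny.
have cosy : cos y <= cos c.
  rewrite leNgt ltr_cos; last 2 first.
  - by rewrite in_itv/= y0/=; rewrite /y in cy *; lra.
  - by rewrite in_itv/= c0/=; rewrite /y in cy *; lra.
  by rewrite -leNgt.
have cosy0 : 0 <= cos y by apply: cos_ge0_pihalf; rewrite /y; apply/andP; split; lra.
have cosx0 : 0 <= cos x by apply: cos_ge0_pihalf; apply/andP; split; lra.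
have xy : x = y *+ 2 by rewrite /y -mulr_natr; field.
have : 2 * (cos y * (cos y * y)) <= sin x.
  by rewrite xy sin_mulr2n siny -[in leRHS]mulr_natl !ler_wpM2l// ler_wpM2r.
apply: le_trans; move: cosx0; rewrite xy cos_mulr2n -mulr_natl => cosx0.
have : 0 <= y * (2 * cos y ^+ 2 - 1) by rewrite mulr_ge0.
by rewrite -/y -mulr_natr; lra.
Qed.

(** With [A = pi (u + v) / 2] and [B = pi (u - v) / 2] the right-hand side is
    [4 |sin A sin B|], and [|sin A| >= |sin B|] because
    [sin A ^ 2 - sin B ^ 2 = sin (pi u) sin (pi v)]. *)
Lemma cos_separation (u v : R) : 0 <= u <= 1 -> 0 <= v <= 1 ->
  (u - v) ^+ 2 <= `|2 * cos (pi * u) - 2 * cos (pi * v)|.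
Proof.
move=> /andP[u0 u1] /andP[v0 v1].
have pi0 := pi_gt0 R; have pi2 := pi_ge2 R.
pose A := pi * (u + v) / 2; pose B := pi * (u - v) / 2.
have -> : pi * u = A + B by rewrite /A /B; field.
have -> : pi * v = A - B by rewrite /A /B; field.
have sAB : 0 <= sin (A + B) * sin (A - B).
  have -> : A + B = pi * u by rewrite /A /B; field.
  have -> : A - B = pi * v by rewrite /A /B; field.
  have sin_pi_ge0 (w : R) : 0 <= w -> w <= 1 -> 0 <= sin (pi * w).
    by move=> w0 w1; apply: sin_ge0_pi; apply/andP; split; nra.
  by rewrite mulr_ge0// sin_pi_ge0.
have sA : sin B ^+ 2 <= sin A ^+ 2.
  move: sAB; rewrite sinD sinB.
  have -> : (sin A * cos B + cos A * sin B) * (sin A * cos B - cos A * sin B) =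
    sin A ^+ 2 * cos B ^+ 2 - cos A ^+ 2 * sin B ^+ 2 by ring.
  by rewrite !cos2sin2 mulrBr mulrBl mulr1 mul1r opprB addrA subrK subr_ge0.
have -> : 2 * cos (A + B) - 2 * cos (A - B) = - (4 * (sin A * sin B)).
  by rewrite cosD cosB; ring.
rewrite normrN 2!normrM ger0_norm//.
have {}sA : `|sin B| <= `|sin A| by rewrite -ler_sqr ?nnegrE// !real_normK ?num_real.
apply: (@le_trans _ _ (4 * `|sin B| ^+ 2)); last first.
  by rewrite ler_wpM2l// expr2 ler_wpM2r.
have -> : `|sin B| = sin `|B|.
  have [B0|B0] := ger0P B.
    by rewrite ger0_norm// sin_ge0_pi// B0/= /B; nra.
  rewrite sinN ltr0_norm// -oppr_gt0 -sinN sin_gt0_pi// oppr_gt0 B0/= /B; nra.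
have nB : `|B| = pi * `|u - v| / 2.
  by rewrite /B !normrM normfV [`|2|]ger0_norm// (ger0_norm (ltW pi0)).
have uv1 : `|u - v| <= 1 by rewrite ler_norml; apply/andP; split; lra.
have uv0 : 0 <= `|u - v| by [].
have : `|B| / 2 <= sin `|B|.
  by apply: ler_sin_half; rewrite normr_ge0/= nB; nra.
rewrite nB => h.
have {}h : `|u - v| / 2 <= sin (pi * `|u - v| / 2) by nra.
rewrite -(real_normK (num_real (u - v))).
have -> : `|u - v| ^+ 2 = 4 * (`|u - v| / 2) ^+ 2 by field.
by rewrite ler_wpM2l// lerXn2r ?nnegrE//; lra.
Qed.

(** For [y] outside [[- 2, 2]] the nearest end of this interval serves as the
    singular point; this makes the bound uniform in [y]. *)
Lemma near_point (y : R) : exists2 v, 0 <= v <= 1 &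
  forall u, 0 <= u <= 1 -> (u - v) ^+ 2 <= `|y - 2 * cos (pi * u)|.
Proof.
have pi0 := pi_gt0 R.
have [y2|y2] := leP `|y| 2.
  have y1 : -1 <= y / 2 <= 1.
    by move: y2; rewrite ler_norml => /andP[a b]; apply/andP; split; lra.
  pose v := acos (y / 2) / pi.
  have v01 : 0 <= v <= 1.
    rewrite divr_ge0 ?acos_ge0 ?(ltW pi0)//= ler_pdivrMr// mul1r.
    exact: acos_lepi.
  exists v => // u u01.
  have E : 2 * cos (pi * v) = y.
    by rewrite /v (mulrCA pi) mulfV ?gt_eqF// mulr1 acosK ?in_itv//=; field.
  by rewrite -E distrC; exact: cos_separation.
have [y0|y0] := leP 0 y.
  rewrite ger0_norm// in y2; exists 0; first by rewrite lexx ler01.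
  move=> u u01; have := @cos_separation u 0 u01; rewrite lexx ler01 mulr0 cos0.
  move=> /(_ isT); rewrite mulr1 distrC ger0_norm; last first.
    by rewrite subr_ge0 ger_pMr ?cos_le1.
  move=> h; apply: le_trans h _; apply: le_trans (ler_norm _).
  by rewrite lerD2r ltW.
rewrite ltr0_norm// in y2; exists 1; first by rewrite lexx ler01.
move=> u u01; have := @cos_separation u 1 u01; rewrite lexx ler01 mulr1 cospi.
have := cos_geN1 (pi * u) => cN1.
move=> /(_ isT); rewrite ger0_norm; last by lra.
move=> h; apply: le_trans h _; rewrite distrC; apply: le_trans (ler_norm _).
lra.
Qed.

End cosine_separation.

Section log_singularity.
Context {R : realType}.
Local Notation RT := (measurableTypeR R).
Local Notation leb := (@lebesgue_measure R).

(** At distance [r] from [v] this counts the integers [j >= 0] with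
    [r <= exp (- j)], of which there are more than [- ln r]; its integral is at
    most a geometric series. *)
Definition log_majorant (v u : R) : \bar R :=
  (\sum_(0 <= j <oo) (\1_(`[(v - expR (- j%:R))%R, (v + expR (- j%:R))%R]%classic : set R) u)%:E)%E.

Definition log_majorant_mass : R := 2 / (1 - expR (- 1)).

Lemma log_majorant_ge0 v u : (0 <= log_majorant v u)%E.
Proof. by apply: nneseries_ge0 => j _ _; rewrite lee_fin. Qed.

Lemma measurable_log_majorant v : measurable_fun [set: RT] (log_majorant v).
Proof.
apply: ge0_emeasurable_sum => [j u _ _|j _]; first by rewrite lee_fin.
by apply/measurable_EFinP; apply: measurable_indic; exact: measurable_itv.
Qed.

Lemma integral_log_majorant v :
  (\int[leb]_(u in `[0%R, 1%R]) log_majorant v u <= log_majorant_mass%:E)%E.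
Proof.
have e1 : 0 < expR (- 1 : R) < 1 by rewrite expR_gt0/= -[X in _ < X]expR0 ltr_expR ltrN10.
have /andP[e0 e1'] := e1.
rewrite integral_nneseries//; last first.
  move=> j; apply/measurable_EFinP; apply: measurable_funTS.
  by apply: measurable_indic; exact: measurable_itv.
have <- : (\sum_(0 <= j <oo) (2 * expR (- 1) ^+ j)%:E = log_majorant_mass%:E)%E.
  apply: nneseries_EFin_cvg.
  have := @cvg_geometric_series R 2 (expR (- 1)); rewrite ger0_norm ?(ltW e0)// => /(_ e1').
  rewrite (_ : series _ = fun N => \sum_(n < N) 2 * expR (- 1) ^+ n)//.
  by apply/funext => N; rewrite /series/= big_mkord.
apply: lee_nneseries => [j _ _|j _].
  by apply: integral_ge0 => u _; rewrite lee_fin.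
rewrite integral_indic//.
apply: (@le_trans _ _ (leb `[v - expR (- j%:R), v + expR (- j%:R)]%classic)).
  by apply: le_measure; rewrite ?inE//; exact: measurableI.
rewrite lebesgue_measure_itv/= lte_fin.
have ej : 0 < expR (- j%:R : R) by exact: expR_gt0.
case: ifP => [_|]; last by have -> : v - expR (- j%:R) < v + expR (- j%:R) by lra.
by rewrite -EFinB lee_fin -expRM_natl mulrN1; lra.
Qed.

Lemma ln_le_log_majorant v u (r : R) : 0 < r -> `|u - v| <= r ->
  ((- ln r)%:E <= log_majorant v u)%E.
Proof.
move=> r0 uvr; have [l0|l0] := leP (- ln r) 0.
  by apply: le_trans (log_majorant_ge0 _ _); rewrite lee_fin.
have /andP[m1 m2] := truncn_itv (ltW l0).
set m := Num.truncn _ in m1 m2.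
apply: le_trans (nneseries_lim_ge m.+1 _); last by move=> j _ _; rewrite lee_fin.
rewrite (eq_big_nat _ _ (F2 := fun=> 1%E)); last first.
  move=> j /andP[_ jm]; rewrite indicE; case: (boolP (_ \in _)) => //.
  move=> /negP[]; rewrite inE/= in_itv/=.
  have : `|u - v| <= expR (- j%:R).
    apply: le_trans uvr _; rewrite -ler_ln ?posrE ?expR_gt0// expRK lerNr.
    by apply: le_trans m1; rewrite ler_nat -ltnS.
  by rewrite ler_norml => /andP[a b]; apply/andP; split; lra.
by rewrite sumEFin lee_fin big_mkord sumr_const card_ord ltW.
Qed.

Definition cheb_kernel (y u : R) : R := ln `|y - 2 * cos (pi * u)|.

Lemma measurable_cos_pi : measurable_fun [set: RT] (fun u : R => cos (pi * u)).
Proof.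
apply: continuous_measurable_fun => u.
apply: (@continuous_comp _ _ _ (fun u : R => pi * u) cos); last exact: continuous_cos.
by apply: cvgMr; exact: cvg_id.
Qed.

Lemma measurable_cheb_kernel y : measurable_fun [set: RT] (cheb_kernel y).
Proof.
apply: measurableT_comp => //; apply: measurableT_comp => //.
by apply: measurable_funB => //; apply: measurable_funM => //; exact: measurable_cos_pi.
Qed.

Lemma normr_cos2 (y u : R) : `|y - 2 * cos (pi * u)| <= `|y| + 2.
Proof.
apply: le_trans (ler_normB _ _) _; rewrite lerD2l normrM ger0_norm//.
by rewrite ler_piMr// ler_norml cos_geN1 cos_le1.
Qed.

(** The majorant is doubled because [near_point] bounds the distance to the
    singularity by a square. *)
Lemma integral_norm_cheb_kernel y :
  (\int[unif]_u `|cheb_kernel y u|%:E <= (`|y| + 2 + 2 * log_majorant_mass)%:E)%E.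
Proof.
have [v v01 yv] := near_point y.
rewrite integral_uniform//; last first.
  by apply/measurable_EFinP; apply: measurableT_comp => //; exact: measurable_cheb_kernel.
rewrite subr0 invr1 mul1e.
apply: (@le_trans _ _ (\int[leb]_(u in `[0%R, 1%R]) ((`|y| + 2)%:E + 2%:E * log_majorant v u))%E).
  apply: ge0_le_integral => //.
  - apply/measurable_EFinP/measurable_funTS; apply: measurableT_comp => //.
    exact: measurable_cheb_kernel.
  - apply: emeasurable_funD => //; apply: measurable_funeM; apply: measurable_funTS.
    exact: measurable_log_majorant.
  - move=> u /=; rewrite in_itv/= => u01; rewrite /cheb_kernel.
    set r := `|y - _|.
    have r0 : 0 <= r by exact: normr_ge0.
    have ry : r <= `|y| + 2 by exact: normr_cos2.
    have g0 : (0 <= 2%:E * log_majorant v u)%E by rewrite mule_ge0// log_majorant_ge0.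
    have [r1|r1] := leP 1 r.
      rewrite ger0_norm ?ln_ge0//; apply: (@le_trans _ _ (`|y| + 2)%:E).
        rewrite lee_fin; apply: le_trans ry; apply/ltW/ln_sublinear.
        exact: lt_le_trans r1.
      by rewrite leeDl.
    rewrite ler0_norm ?ln_le0// ?(ltW r1)//.
    apply: (@le_trans _ _ (2%:E * log_majorant v u)%E); last first.
      by rewrite leeDr// lee_fin addr_ge0.
    have [->|rn0] := eqVneq r 0; first by rewrite ln0// oppr0.
    have {}r0 : 0 < r by rewrite lt_neqAle eq_sym rn0.
    have sr0 : 0 < Num.sqrt r by rewrite sqrtr_gt0.
    apply: (@le_trans _ _ (2%:E * (- ln (Num.sqrt r))%:E)%E).
      rewrite -EFinM lee_fin mulrN lerN2 mulr_natl -lnXn//.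
      by rewrite sqr_sqrtr// ltW.
    rewrite lee_pmul2l// ln_le_log_majorant//.
    by rewrite -sqrtr_sqr ler_wsqrtr// yv.
rewrite ge0_integralD//=; last 2 first.
- by move=> u _; rewrite mule_ge0// log_majorant_ge0.
- by apply: measurable_funeM; apply: measurable_funTS; exact: measurable_log_majorant.
rewrite integral_cst//= lebesgue_measure_itv/= lte_fin ltr01 sube0 mule1.
rewrite ge0_integralZl//; last 2 first.
- by apply: measurable_funTS; exact: measurable_log_majorant.
- by move=> u _; exact: log_majorant_ge0.
by rewrite [leRHS]EFinD EFinM leeD2l// lee_pmul2l// integral_log_majorant.
Qed.

End log_singularity.

(** * The potential of the arcsine law *)

Section chebyshev_potential.
Context {R : realType}.
Local Notation RT := (measurableTypeR R).
Implicit Types y u v : R.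

Definition cheb_potential y : R := \int[unif]_u cheb_kernel y u.

Lemma integrable_cheb_kernel y :
  unif.-integrable [set: RT] (EFin \o cheb_kernel y).
Proof.
apply/integrableP; split.
  by apply/measurable_EFinP; exact: measurable_cheb_kernel.
exact: le_lt_trans (integral_norm_cheb_kernel y) (ltry _).
Qed.

Lemma normr_cheb_potential y :
  `|cheb_potential y| <= `|y| + 2 + 2 * log_majorant_mass.
Proof.
rewrite -lee_fin /cheb_potential EFin_normr_Rintegral//; last exact: integrable_cheb_kernel.
apply: le_trans (integral_norm_cheb_kernel y).
apply: le_abse_integral => //.
by apply/measurable_EFinP; exact: measurable_cheb_kernel.
Qed.

Lemma measurable_cheb_null y : measurable ([set u | y = 2 * cos (pi * u)] : set RT).
Proof.
rewrite (_ : [set u | _] = (fun u => 2 * cos (pi * u)) @^-1` [set y]); last first.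
  by apply/seteqP; split => u /=.
rewrite -[X in measurable X]setTI; apply: measurable_funM => //.
exact: measurable_cos_pi.
Qed.

Lemma unif_cheb_null y : unif ([set u | y = 2 * cos (pi * u)] : set RT) = 0%E.
Proof.
have [v v01 yv] := near_point y.
apply: (@unif_null _ _ v); first exact: measurable_cheb_null.
move=> u u01 /= yu; have := yv u u01.
rewrite yu subrr normr0 => h; apply/eqP; rewrite -subr_eq0 -sqrf_eq0 eq_le h.
exact: sqr_ge0.
Qed.

Lemma cheb_kernel_flip y u : cheb_kernel y (1 - u) = ln `|y + 2 * cos (pi * u)|.
Proof.
by rewrite /cheb_kernel mulrBr mulr1 cosB cospi sinpi mul0r addr0 mulN1r mulrN opprK.
Qed.

Lemma cos_tent u : 2 * cos (pi * tent u) = (2 * cos (pi * u)) ^+ 2 - 2.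
Proof.
rewrite /tent mulrBr mulr1 cosB cospi sinpi mul0r addr0 mulN1r.
have -> : cos (pi * `|1 - 2 * u|) = cos (pi * (1 - 2 * u)).
  by case: (ger0P (1 - 2 * u)) => // _; rewrite mulrN cosN.
have -> : pi * (1 - 2 * u) = pi - (pi * u) *+ 2 by rewrite -mulr_natr; ring.
rewrite cosB cospi sinpi mul0r addr0 mulN1r opprK cos_mulr2n -mulr_natr; ring.
Qed.

(** The arcsine law is invariant under [x -> - x] and under the Chebyshev map
    [x -> x ^ 2 - 2]; factoring [y ^ 2 - x ^ 2] gives the functional equation. *)
Lemma cheb_potential_double y : 2 * cheb_potential y = cheb_potential (y ^+ 2 - 2).
Proof.
have iy := integrable_cheb_kernel y.
have iy2 := integrable_cheb_kernel (y ^+ 2 - 2).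
have iyf := integrable_transport transports_flip iy.
rewrite mulr_natl mulr2n {2}/cheb_potential (integral_transport transports_flip iy).
rewrite -RintegralD//.
rewrite /cheb_potential (integral_transport transports_tent iy2).
(* the singular points are excluded, since [ln 0 = 0] breaks the product rule *)
apply: (@Rintegral_ae _ _ ([set u | y = 2 * cos (pi * u)] `|` [set u | - y = 2 * cos (pi * u)])).
- by apply: measurableU; exact: measurable_cheb_null.
- apply/eqP; rewrite -measure_le0; apply: le_trans (measureU2 _ _ _) _.
  + exact: measurable_cheb_null.
  + exact: measurable_cheb_null.
  + have e0 z : (unif ([set u | z = (2 * cos (pi * u))%R] : set RT) <= 0)%E.
      by rewrite unif_cheb_null.
    by rewrite -[leRHS]adde0; apply: leeD; exact: e0.
- apply: measurable_funD; first exact: measurable_cheb_kernel.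
  apply: (measurableT_comp (measurable_cheb_kernel y)); exact: measurable_funB.
- by apply: (measurableT_comp (measurable_cheb_kernel _)); exact: measurable_tent.
move=> u /not_orP[/eqP yu /eqP yu'].
rewrite cheb_kernel_flip /cheb_kernel cos_tent -lnM ?posrE ?normr_gt0 ?subr_eq0//; last first.
  by rewrite addrC -[y]opprK subr_eq0 eq_sym.
rewrite -normrM; congr (ln `|_|); ring.
Qed.

Lemma cheb_potentialN y : cheb_potential (- y) = cheb_potential y.
Proof.
have : 2 * cheb_potential (- y) = 2 * cheb_potential y.
  by rewrite !cheb_potential_double sqrrN.
by apply: mulfI.
Qed.

(** How the functional equation is used: a quantity that doubles at each step
    and remains bounded is zero. *)
Lemma eq0_expn2_bounded (x M : R) : (forall n, 2 ^+ n * `|x| <= M) -> x = 0.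
Proof.
move=> xM; apply: contrapT => /eqP x0.
have x0' : 0 < `|x| by rewrite normr_gt0.
have := xM (Num.truncn (M / `|x|)).+1; rewrite -ler_pdivlMr// leNgt => /negP; apply.
apply: lt_le_trans (truncnS_gt _) _.
by rewrite -natrX ler_nat ltnW// ltn_expl.
Qed.

Lemma cheb_potential_in y : `|y| <= 2 -> cheb_potential y = 0.
Proof.
move=> y2; apply: (@eq0_expn2_bounded _ (2 + 2 + 2 * log_majorant_mass)) => n.
elim: n y y2 => [|n IH] y y2.
  by rewrite expr0 mul1r; apply: le_trans (normr_cheb_potential y) _; rewrite !lerD2r.
rewrite exprSr -mulrA (_ : 2 * `|_| = `|2 * cheb_potential y|); last first.
  by rewrite normrM ger0_norm.
rewrite cheb_potential_double.
apply: IH; move: y2; rewrite !ler_norml => /andP[a b].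
by apply/andP; split; nra.
Qed.

(** [v + 1 / v - 2] and [v + 1 / v + 2] are [v (1 - 1 / v) ^ 2] and
    [v (1 + 1 / v) ^ 2], and [ln (1 + 1 / v) <= - ln (1 - 1 / v)]. *)
Lemma cheb_kernel_bounds v u : 1 < v ->
  ln v + 2 * ln (1 - v^-1) <= cheb_kernel (v + v^-1) u <= ln v - 2 * ln (1 - v^-1).
Proof.
move=> v1; have v0 : 0 < v by apply: lt_trans v1.
have iv0 : 0 < v^-1 by rewrite invr_gt0.
have iv1 : v^-1 < 1 by rewrite invf_lt1.
have w0 : 0 < 1 - v^-1 by rewrite subr_gt0.
have vv : v * v^-1 = 1 by rewrite mulfV// gt_eqF.
have cN1 := cos_geN1 (pi * u); have c1 := cos_le1 (pi * u).
have lo : v * (1 - v^-1) ^+ 2 = v + v^-1 - 2.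
  have -> : v * (1 - v^-1) ^+ 2 = v - 2 * (v * v^-1) + v * v^-1 * v^-1 by ring.
  by rewrite vv; ring.
have hi : v * (1 + v^-1) ^+ 2 = v + v^-1 + 2.
  have -> : v * (1 + v^-1) ^+ 2 = v + 2 * (v * v^-1) + v * v^-1 * v^-1 by ring.
  by rewrite vv; ring.
have lo0 : 0 < v * (1 - v^-1) ^+ 2 by rewrite mulr_gt0// exprn_gt0.
have k0 : 0 < v + v^-1 - 2 * cos (pi * u) by rewrite lo in lo0; lra.
rewrite /cheb_kernel gtr0_norm//; apply/andP; split.
  rewrite mulr_natl -lnXn// -lnM ?posrE ?exprn_gt0// ler_ln ?posrE// lo; lra.
apply: (@le_trans _ _ (ln (v * (1 + v^-1) ^+ 2))).
  by rewrite ler_ln ?posrE// hi; lra.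
have p0 : 0 < 1 + v^-1 by lra.
rewrite lnM ?posrE ?exprn_gt0// lnXn// mulr2n.
suff : ln (1 + v^-1) <= - ln (1 - v^-1) by lra.
rewrite -lnV ?posrE// ler_ln ?posrE ?invr_gt0//.
rewrite -[leRHS]mul1r ler_pdivlMr//.
have -> : (1 + v^-1) * (1 - v^-1) = 1 - v^-1 ^+ 2 by ring.
by rewrite lerBlDr lerDl sqr_ge0.
Qed.

Lemma le_Rintegral_cst (f : R -> R) (a b : R) :
  unif.-integrable [set: RT] (EFin \o f) -> (forall u, a <= f u <= b) ->
  a <= \int[unif]_u f u <= b.
Proof.
move=> fi fab.
have ci (c : R) : unif.-integrable [set: RT] (EFin \o cst c).
  exact: finite_measure_integrable_cst.
have cE (c : R) : \int[@unif R]_u (cst c) u = c.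
  by rewrite Rintegral_cst// [X in fine X]probability_setT mulr1.
apply/andP; split; [rewrite -[leLHS]cE|rewrite -[leRHS]cE];
  by apply: le_Rintegral => // u _; case/andP: (fab u).
Qed.

(** Outside the support: in the coordinate [v + 1 / v] the Chebyshev map is
    [v -> v ^ 2], and the potential at [v + 1 / v] is [ln v] up to an error that
    stays bounded along the orbit. *)
Lemma cheb_potential_out v : 1 < v -> cheb_potential (v + v^-1) = ln v.
Proof.
move=> v1; apply/eqP; rewrite -subr_eq0; apply/eqP.
pose M := - (2 * ln (1 - v^-1)).
apply: (@eq0_expn2_bounded _ M) => n.
(* the bound [M] must be uniform along the orbit, hence the generalization *)
suff : forall w, v <= w -> 2 ^+ n * `|cheb_potential (w + w^-1) - ln w| <= M by exact.
elim: n => [|n IH] w vw.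
  rewrite expr0 mul1r.
  have w1 : 1 < w by apply: lt_le_trans vw.
  have w0 : 0 < w by apply: lt_trans w1.
  have v0 : 0 < v by apply: lt_trans v1.
  have /andP[lo hi] := le_Rintegral_cst (integrable_cheb_kernel (w + w^-1))
    (fun u => cheb_kernel_bounds u w1).
  have : ln (1 - v^-1) <= ln (1 - w^-1).
    rewrite ler_ln ?posrE ?subr_gt0 ?invf_lt1//.
    by rewrite lerD2l lerN2 lef_pV2 ?posrE.
  move: lo hi; rewrite -/(cheb_potential _) /M => lo hi vw'.
  by rewrite ler_norml; apply/andP; split; lra.
have w1 : 1 < w by apply: lt_le_trans vw.
have w0 : 0 < w by apply: lt_trans w1.
rewrite exprSr -mulrA (_ : 2 * `|_| = `|2 * (cheb_potential (w + w^-1) - ln w)|).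
  2: by rewrite normrM ger0_norm.
rewrite mulrBr cheb_potential_double.
rewrite [2 * ln w]mulr_natl -lnXn//.
have -> : (w + w^-1) ^+ 2 - 2 = w ^+ 2 + (w ^+ 2)^-1.
  by field; rewrite gt_eqF.
apply: IH; apply: le_trans vw _.
by rewrite expr2 ler_pMl// ltW.
Qed.

End chebyshev_potential.

(** * The interval and the map carrying the balayage to the arcsine law *)

Lemma within_continuous_compW (R : realType) (A B : set R) (f g : R -> R) :
  (forall x, A x -> B (f x)) ->
  {within A, continuous f} -> {within B, continuous g} ->
  {within A, continuous (g \o f)}.
Proof.
move=> AB /subspace_continuousP cf /subspace_continuousP cg.
apply/subspace_continuousP => x Ax.
apply: (cvg_comp _ _ _ (cg _ (AB _ Ax))) => U hU.
have h : nbhs x [set y | A y -> B (f y) -> U (f y)] := cf x Ax _ hU.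
suff : nbhs x [set y | A y -> U (f y)] by [].
by apply: filterS h => y h Ay; exact: h Ay (AB _ Ay).
Qed.

Lemma within_continuous_acos (R : realType) :
  {within `[(-1 : R), 1], continuous (@acos R)}.
Proof.
rewrite -cospi -cos0; apply: segment_can_ge_continuous; first exact: pi_ge0.
  by apply: continuous_subspaceT => x; exact: continuous_cos.
exact: cosK.
Qed.

Section parameters.
Context {R : realType} (s : R) (s1 : 1 < s).
Implicit Types x : R.

Definition endpoint : R := Num.sqrt (2 * s - 1) / (s - 1).

Definition slope : R := s / (s - 1).

Lemma sB1_gt0 : 0 < s - 1. Proof. by rewrite subr_gt0. Qed.

Lemma endpoint_gt0 : 0 < endpoint.
Proof. by rewrite divr_gt0 ?sB1_gt0// sqrtr_gt0; have := s1; lra. Qed.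

Lemma slope_gt1 : 1 < slope.
Proof. by rewrite /slope ltr_pdivlMr ?sB1_gt0//; have := s1; lra. Qed.

Lemma slope_gt0 : 0 < slope.
Proof. exact: lt_trans slope_gt1. Qed.

Lemma slopeE : s = (s - 1) * slope.
Proof. by rewrite /slope mulrCA mulfV ?mulr1// gt_eqF// sB1_gt0. Qed.

Lemma sqr_endpoint : endpoint ^+ 2 = (2 * s - 1) / (s - 1) ^+ 2.
Proof. by rewrite /endpoint expr_div_n sqr_sqrtr//; have := s1; lra. Qed.

Lemma sqr_slope : slope ^+ 2 = 1 + endpoint ^+ 2.
Proof.
rewrite sqr_endpoint /slope; have := sB1_gt0 => h.
by field; rewrite gt_eqF.
Qed.

(** [stretch] maps [-endpoint, endpoint] onto itself and carries the balayage
    of the point [i] onto this interval to its arcsine law. *)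
Definition stretch x : R := slope * x / Num.sqrt (1 + x ^+ 2).

Definition unstretch x : R := x / Num.sqrt (slope ^+ 2 - x ^+ 2).

Lemma sqrt_sqrD1_gt0 x : 0 < Num.sqrt (1 + x ^+ 2).
Proof. by rewrite sqrtr_gt0 sqrD1_gt0. Qed.

Lemma sqr_stretch x : stretch x ^+ 2 = slope ^+ 2 * x ^+ 2 / (1 + x ^+ 2).
Proof.
by rewrite /stretch expr_div_n exprMn sqr_sqrtr// ltW// sqrD1_gt0.
Qed.

Lemma endpointB_stretch x :
  endpoint ^+ 2 - stretch x ^+ 2 = (endpoint ^+ 2 - x ^+ 2) / (1 + x ^+ 2).
Proof.
rewrite sqr_stretch sqr_slope; have := sqrD1_gt0 x => h.
by field; rewrite gt_eqF.
Qed.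

Lemma normr_stretch_le x : (`|stretch x| <= endpoint) = (`|x| <= endpoint).
Proof.
have a0 := ltW endpoint_gt0.
rewrite -[LHS]ler_sqr ?nnegrE// -[RHS]ler_sqr ?nnegrE// !real_normK ?num_real//.
rewrite -subr_ge0 endpointB_stretch -[RHS]subr_ge0.
by rewrite pmulr_lge0// invr_gt0 sqrD1_gt0.
Qed.

Lemma ltr_stretch x y : (stretch x < stretch y) = (x < y).
Proof.
suff mono (u v : R) : u < v -> stretch u < stretch v.
  case: (ltgtP x y) => [|/mono/ltW yx|->]; [exact: mono| |by rewrite ltxx].
  by rewrite ltNge yx.
have pos (p q : R) : 0 <= p -> p < q -> p * Num.sqrt (1 + q ^+ 2) < q * Num.sqrt (1 + p ^+ 2).
  move=> p0 pq; have q0 : 0 <= q by apply/ltW/(le_lt_trans p0).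
  rewrite -ltr_sqr ?nnegrE ?mulr_ge0 ?sqrtr_ge0//.
  rewrite !exprMn !sqr_sqrtr ?(ltW (sqrD1_gt0 _))//.
  have : p ^+ 2 < q ^+ 2 by rewrite ltr_sqr ?nnegrE.
  lra.
move=> uv; rewrite /stretch -!(mulrA slope) ltr_pM2l ?slope_gt0//.
rewrite ltr_pdivrMr ?sqrt_sqrD1_gt0// mulrAC ltr_pdivlMr ?sqrt_sqrD1_gt0//.
have [u0|u0] := leP 0 u; first exact: pos.
have [v0|v0] := leP 0 v.
  apply: (@lt_le_trans _ _ 0).
    by rewrite pmulr_llt0 ?sqrt_sqrD1_gt0.
  by rewrite mulr_ge0 ?sqrtr_ge0.
have := @pos (- v) (- u); rewrite !sqrrN; lra.
Qed.

End parameters.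

(** * The equilibrium density and its distribution function *)

Section equilibrium_cdf.
Context {R : realType} (s : R) (s1 : 1 < s).
Local Notation RT := (measurableTypeR R).
Local Notation leb := (@lebesgue_measure R).
Local Notation a := (endpoint s).
Local Notation b := (slope s).
Implicit Types x : R.

(** The square root of a negative number being zero, this vanishes outside
    [[- a, a]]: its integral over a set is that over the part of the set inside
    the support. *)
Definition density x : R :=
  Num.sqrt (2 * s - 1 - (s - 1) ^+ 2 * x ^+ 2) / (pi * (1 + x ^+ 2)).

Definition arcsine_cdf x : R := 1 - acos (x / a) / pi.

Definition equilibrium_cdf x : R :=
  s * arcsine_cdf (stretch s x) - (s - 1) * arcsine_cdf x.

Lemma density_ge0 x : 0 <= density x.
Proof.
rewrite divr_ge0 ?sqrtr_ge0// mulr_ge0 ?pi_ge0// ltW//; exact: sqrD1_gt0.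
Qed.

Lemma endpoint_itv x : (-1 <= x / a <= 1) = (`|x| <= a).
Proof.
have a0 := endpoint_gt0 s1.
by rewrite ler_norml ler_pdivlMr// ler_pdivrMr// mulN1r mul1r.
Qed.

Lemma endpoint_itvo x : (-1 < x / a < 1) = (`|x| < a).
Proof.
have a0 := endpoint_gt0 s1.
by rewrite ltr_norml ltr_pdivlMr// ltr_pdivrMr// mulN1r mul1r.
Qed.

Lemma densityE x : density x =
  (s - 1) * a * Num.sqrt (1 - (x / a) ^+ 2) / (pi * (1 + x ^+ 2)).
Proof.
have a0 := endpoint_gt0 s1; have c0 := sB1_gt0 s1.
congr (_ / _).
have key : (s - 1) ^+ 2 * a ^+ 2 = 2 * s - 1.
  by rewrite sqr_endpoint// mulrC divfK// expf_neq0// gt_eqF.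
have -> : 2 * s - 1 - (s - 1) ^+ 2 * x ^+ 2 = ((s - 1) * a) ^+ 2 * (1 - (x / a) ^+ 2).
  by rewrite -key; move: a0; set A := endpoint s => A0; field; rewrite gt_eqF.
by rewrite sqrtrM ?sqr_ge0// sqrtr_sqr ger0_norm// mulr_ge0// ltW.
Qed.

Lemma density_out x : a < `|x| -> density x = 0.
Proof.
move=> ax; rewrite /density ler0_sqrtr ?mul0r//.
have c0 := sB1_gt0 s1.
have : a ^+ 2 <= x ^+ 2.
  rewrite -[x ^+ 2]real_normK ?num_real// ler_sqr ?nnegrE ?(ltW ax)//.
  exact/ltW/endpoint_gt0.
by rewrite sqr_endpoint// ler_pdivrMr ?exprn_gt0// -subr_le0 [x ^+ 2 * _]mulrC.
Qed.

Lemma continuous_density : continuous density.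
Proof.
move=> x; apply: cvgM.
  apply: (@continuous_comp _ _ _ (fun x => 2 * s - 1 - (s - 1) ^+ 2 * x ^+ 2) Num.sqrt).
    apply: cvgB; first exact: cvg_cst.
    by apply: cvgM; [exact: cvg_cst|exact: exprn_continuous].
  exact: sqrt_continuous.
apply: cvgV; first by rewrite mulf_neq0 ?gt_eqF ?pi_gt0 ?sqrD1_gt0.
apply: cvgM; first exact: cvg_cst.
by apply: cvgD; [exact: cvg_cst|exact: exprn_continuous].
Qed.

Lemma measurable_density : measurable_fun [set: RT] density.
Proof. by apply: continuous_measurable_fun; exact: continuous_density. Qed.

Lemma is_derive_arcsine_cdf x : `|x| < a ->
  is_derive x 1 arcsine_cdf (pi * a * Num.sqrt (1 - (x / a) ^+ 2))^-1.
Proof.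
rewrite -endpoint_itvo => xa.
have h1 : is_derive x 1 (fun y : R => y / a) a^-1.
  have := is_deriveZ a^-1 (is_derive_id x (1 : R)).
  rewrite (_ : _ \*: _ = (fun y : R => y / a)); last first.
    by apply/funext => y; rewrite /= mulrC.
  by rewrite scaler1.
have h2 := is_derive1_acos xa.
have h3 := is_deriveZ pi^-1 (@is_derive1_comp R (@acos R) (fun y => y / a) x _ _ h2 h1).
have := is_deriveB (is_derive_cst (1 : R) x 1) h3.
rewrite (_ : _ - _ = arcsine_cdf); last first.
  by apply/funext => y; rewrite /arcsine_cdf /= mulrC.
rewrite (_ : _ - _ = (pi * a * Num.sqrt (1 - (x / a) ^+ 2))^-1)//.
by rewrite sub0r mulNr scalerN opprK -[LHS]/(_ * _) !invfM; ring.
Qed.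

Lemma is_derive_sqrt_sqrD1 x :
  is_derive x 1 (fun y : R => Num.sqrt (1 + y ^+ 2)) (x / Num.sqrt (1 + x ^+ 2)).
Proof.
have h1 : is_derive x 1 (fun y : R => 1 + y ^+ 2) (2 * x).
  have := is_deriveD (is_derive_cst (1 : R) x 1) (is_deriveX 2 (is_derive_id x (1 : R))).
  rewrite (_ : _ + _ = (fun y : R => 1 + y ^+ 2)); last first.
    by apply/funext => y; rewrite /= exprfctE.
  by rewrite add0r scaler1.
have h2 := is_derive1_sqrt (sqrD1_gt0 x).
have := @is_derive1_comp R Num.sqrt (fun y : R => 1 + y ^+ 2) x _ _ h2 h1.
rewrite (_ : _^-1 * _ = x / Num.sqrt (1 + x ^+ 2))//.
by have := sqrt_sqrD1_gt0 x => h; field; rewrite gt_eqF.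
Qed.

Lemma is_derive_stretch x :
  is_derive x 1 (stretch s) (b / ((1 + x ^+ 2) * Num.sqrt (1 + x ^+ 2))).
Proof.
have r0 := sqrt_sqrD1_gt0 x.
have h1 := is_derive_sqrt_sqrD1 x.
have h2 := @is_deriveV R (fun y : R => Num.sqrt (1 + y ^+ 2)) x _ 1 (lt0r_neq0 r0) h1.
have h3 := is_deriveZ b (is_deriveM (is_derive_id x (1 : R)) h2).
move: h3; rewrite (_ : _ \*: _ = stretch s); last first.
  by apply/funext => y; rewrite /stretch /= -mulrA.
rewrite (_ : _ *: _ = b / ((1 + x ^+ 2) * Num.sqrt (1 + x ^+ 2)))//.
rewrite scaler1 -[LHS]/(b * (x * (- Num.sqrt (1 + x ^+ 2) ^- 2 * (x / Num.sqrt (1 + x ^+ 2)))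
  + (Num.sqrt (1 + x ^+ 2))^-1)).
have E := sqr_sqrtr (ltW (sqrD1_gt0 x)).
move: r0 E; set r := Num.sqrt _ => r0 E.
have F : r ^+ 2 - x ^+ 2 = 1 by rewrite E addrK.
have -> : x * (- r ^- 2 * (x / r)) + r^-1 = (r ^+ 2 - x ^+ 2) / (r ^+ 2 * r).
  by field; rewrite gt_eqF.
by rewrite F mul1r E.
Qed.

Lemma sqrt_stretch x : `|x| < a ->
  Num.sqrt (1 - (stretch s x / a) ^+ 2) = Num.sqrt (1 - (x / a) ^+ 2) / Num.sqrt (1 + x ^+ 2).
Proof.
move=> xa; have a0 := endpoint_gt0 s1; have x0 := sqrD1_gt0 x.
have x1 : 0 <= 1 - (x / a) ^+ 2.
  by move: xa; rewrite -endpoint_itvo => /andP[h1 h2]; nra.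
rewrite -sqrtrV ?(ltW x0)// -sqrtrM//; congr Num.sqrt.
have := endpointB_stretch s1 x; move: a0; set A := endpoint s; set t := stretch s x => A0 E.
have -> : 1 - (t / A) ^+ 2 = (A ^+ 2 - t ^+ 2) / A ^+ 2 by field; rewrite gt_eqF.
by rewrite E; field; rewrite !gt_eqF.
Qed.

(** Under [stretch] the square root [sqrt (a ^ 2 - x ^ 2)] is divided by
    [sqrt (1 + x ^ 2)]; then [b ^ 2 - (1 + x ^ 2) = a ^ 2 - x ^ 2] moves the
    square root from the denominator to the numerator. *)
Lemma is_derive_equilibrium_cdf x : `|x| < a ->
  is_derive x 1 equilibrium_cdf (density x).
Proof.
move=> xa; have a0 := endpoint_gt0 s1; have x0 := sqrD1_gt0 x.
have ta : `|stretch s x| < a.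
  rewrite -ltr_sqr ?nnegrE ?(ltW a0)// real_normK ?num_real//.
  rewrite -subr_gt0 endpointB_stretch// divr_gt0// subr_gt0.
  by rewrite -[x ^+ 2]real_normK ?num_real// ltr_sqr ?nnegrE ?(ltW a0).
have h1 := is_derive_arcsine_cdf xa.
have h2 := @is_derive1_comp R arcsine_cdf (stretch s) x _ _ (is_derive_arcsine_cdf ta)
  (is_derive_stretch x).
have := is_deriveB (is_deriveZ s h2) (is_deriveZ (s - 1) h1).
rewrite (_ : _ - _ = equilibrium_cdf)//.
rewrite (_ : _ - _ = density x)// sqrt_stretch// densityE.
have S0 : 0 < Num.sqrt (1 - (x / a) ^+ 2).
  by rewrite sqrtr_gt0; move: xa; rewrite -endpoint_itvo => /andP[p1 p2]; nra.
have S2 : a ^+ 2 * Num.sqrt (1 - (x / a) ^+ 2) ^+ 2 = a ^+ 2 - x ^+ 2.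
  rewrite sqr_sqrtr; last by rewrite ltW// -sqrtr_gt0.
  by move: a0; set A := endpoint s => A0; field; rewrite gt_eqF.
have r0 := sqrt_sqrD1_gt0 x; have pi0 := pi_gt0 R; have b2 := sqr_slope s1.
have sE := slopeE s1.
move: S0 S2 r0 b2 sE a0; set S := Num.sqrt (1 - _); set r := Num.sqrt (1 + _).
set A := endpoint s; set B := slope s => S0 S2 r0 b2 sE A0.
rewrite -![_ *: _]/(_ * _); move: pi0; generalize (@pi R) => P P0.
have -> : s * ((P * A * (S / r))^-1 * (B / ((1 + x ^+ 2) * r))) -
    (s - 1) * (P * A * S)^-1 = (s * B - (s - 1) * (1 + x ^+ 2)) / (P * A * S * (1 + x ^+ 2)).
  by field; rewrite !gt_eqF.
rewrite [in s * B]sE.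
have -> : (s - 1) * B * B - (s - 1) * (1 + x ^+ 2) = (s - 1) * (A ^+ 2 * S ^+ 2).
  by rewrite S2 -mulrA -expr2 b2; ring.
by field; rewrite !gt_eqF.
Qed.

Lemma continuous_stretch : continuous (stretch s).
Proof.
move=> x; apply: differentiable_continuous; apply/derivable1_diffP.
by apply: ex_derive; exact: is_derive_stretch.
Qed.

Lemma within_continuous_arcsine_cdf : {within `[- a, a], continuous arcsine_cdf}.
Proof.
apply: (@within_continuous_compW _ _ `[(-1 : R), 1]%classic (fun x => x / a) (fun y => 1 - acos y / pi)).
- by move=> x /=; rewrite !in_itv/= endpoint_itv ler_norml.
- apply: continuous_subspaceT => x; apply: cvgMl; exact: cvg_id.
- move=> x; apply: cvgB; first exact: cvg_cst.
  by apply: cvgMl; exact: within_continuous_acos.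
Qed.

Lemma within_continuous_equilibrium_cdf :
  {within `[- a, a], continuous equilibrium_cdf}.
Proof.
move=> x; apply: cvgB; apply: cvgMr; last exact: within_continuous_arcsine_cdf.
apply: (@within_continuous_compW _ _ `[- a, a]%classic (stretch s) arcsine_cdf).
- by move=> y /=; rewrite !in_itv/= -!ler_norml normr_stretch_le.
- by apply: continuous_subspaceT => y; exact: continuous_stretch.
- exact: within_continuous_arcsine_cdf.
Qed.

Lemma stretch_endpoint : stretch s a = a.
Proof.
have a0 := endpoint_gt0 s1; have b0 := slope_gt0 s1.
rewrite /stretch -sqr_slope// sqrtr_sqr ger0_norm ?(ltW b0)//.
by rewrite mulrAC mulfV ?mul1r// gt_eqF.
Qed.

Lemma stretchN x : stretch s (- x) = - stretch s x.
Proof. by rewrite /stretch sqrrN mulrN mulNr. Qed.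

Lemma arcsine_cdf_endpoint : arcsine_cdf a = 1.
Proof.
by rewrite /arcsine_cdf mulfV ?gt_eqF ?endpoint_gt0// acos1 mul0r subr0.
Qed.

Lemma arcsine_cdfN_endpoint : arcsine_cdf (- a) = 0.
Proof.
rewrite /arcsine_cdf mulNr mulfV ?gt_eqF ?endpoint_gt0// acosN1 mulfV ?subrr//.
by rewrite gt_eqF ?pi_gt0.
Qed.

Lemma integral_density x : - a <= x <= a ->
  (\int[leb]_(t in `[(- a)%R, x]) (density t)%:E = (equilibrium_cdf x)%:E)%E.
Proof.
have a0 := endpoint_gt0 s1.
have E0 : equilibrium_cdf (- a) = 0.
  by rewrite /equilibrium_cdf stretchN stretch_endpoint arcsine_cdfN_endpoint; ring.
move=> /andP[]; rewrite le_eqVlt => /predU1P[<- _|ax xa].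
  by rewrite E0 set_itv1 integral_set1.
rewrite (@continuous_FTC2 _ density equilibrium_cdf)//.
- by rewrite E0 sube0.
- by apply: continuous_subspaceT => t; exact: continuous_density.
- have : {within `[- a, x], continuous equilibrium_cdf}.
    apply: continuous_subspaceW within_continuous_equilibrium_cdf.
    by move=> t /=; rewrite !in_itv/= => /andP[-> /le_trans]; exact.
  move=> /(continuous_within_itvP _ ax)[_ l r].
  split; [move=> t|exact: l|exact: r].
  rewrite in_itv => /andP[at_ tx].
  have ta : `|t| < a by rewrite ltr_norml; apply/andP; split; [exact: at_|exact: lt_le_trans tx xa].
  by have [] := is_derive_equilibrium_cdf ta.
- move=> t; rewrite in_itv/= => /andP[at_ tx].
  have h : is_derive t 1 equilibrium_cdf (density t).
    by apply: is_derive_equilibrium_cdf; rewrite ltr_norml at_ (lt_le_trans tx).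
  by rewrite derive1E derive_val.
Qed.

End equilibrium_cdf.

(** * The equilibrium measure as a signed combination *)

Section equilibrium_measure.
Context {R : realType} (s : R) (s1 : 1 < s).
Local Notation RT := (measurableTypeR R).
Local Notation leb := (@lebesgue_measure R).
Local Notation a := (endpoint s).
Local Notation b := (slope s).

(** The proof [h] is an argument so that the probability structure, which holds
    only for [1 < s], can be attached to this set function. *)
Definition equilibrium (h : 1 < s) (A : set RT) : \bar R :=
  (\int[leb]_(x in A) (density s x)%:E)%E.

Let equilibrium0 : equilibrium s1 set0 = 0%E.
Proof. by rewrite /equilibrium integral_set0. Qed.

Let equilibrium_ge0 A : (0 <= equilibrium s1 A)%E.
Proof. by apply: integral_ge0 => x _; rewrite lee_fin density_ge0. Qed.

Let equilibrium_sigma_additive : semi_sigma_additive (equilibrium s1).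
Proof.
move=> /= F mF tF mUF; rewrite /equilibrium; apply: cvg_toP.
  apply: ereal_nondecreasing_is_cvgn => m n mn.
  apply: lee_sum_nneg_natr => // k _ _.
  by apply: integral_ge0 => /= x Fkx; rewrite lee_fin density_ge0.
rewrite ge0_integral_bigcup//=.
- by apply: measurable_funTS; apply/measurable_EFinP; exact: measurable_density.
- by move=> x _; rewrite lee_fin density_ge0.
Qed.

HB.instance Definition _ := isMeasure.Build _ _ _ (equilibrium s1)
  equilibrium0 equilibrium_ge0 equilibrium_sigma_additive.

Lemma integral_density_eq (A B : set RT) : measurable A -> measurable B ->
  (forall x, `|x| <= a -> A x <-> B x) ->
  (\int[leb]_(x in A) (density s x)%:E = \int[leb]_(x in B) (density s x)%:E)%E.
Proof.
move=> mA mB AB; rewrite integral_mkcond [RHS]integral_mkcond.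
apply: eq_integral => x _; rewrite !patchE.
have [xa|xa] := leP `|x| a; last by rewrite density_out//; do 2 case: ifP.
have [h1 h2] := AB x xa.
have -> : (x \in A) = (x \in B) by apply/idP/idP; rewrite !inE.
by [].
Qed.

(** The three cases of a distribution function supported on [[- a, a]]. *)
Definition clamp (c : R) : R := if c < - a then - a else if a < c then a else c.

Lemma clampP (c : R) : - a <= clamp c <= a.
Proof.
have a0 := endpoint_gt0 s1.
by rewrite /clamp; case: ltP => ca; [|case: ltP => ac]; apply/andP; split; lra.
Qed.

Lemma equilibrium_ray (c : R) :
  equilibrium s1 `]-oo, c[%classic = (equilibrium_cdf s (clamp c))%:E.
Proof.
have a0 := endpoint_gt0 s1.
rewrite -(integral_density s1 (clampP c)) /equilibrium /clamp.
have [ca|ca] := ltP c (- a).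
  rewrite set_itv1 integral_set1 (@integral_density_eq _ set0) ?integral_set0//.
  move=> x; rewrite ler_norml => /andP[x1 x2]; split => //.
  by rewrite /= in_itv/= => xc; have := lt_trans (le_lt_trans x1 xc) ca; rewrite ltxx.
have [ac|ac] := ltP a c.
  apply: integral_density_eq => //.
  move=> x; rewrite ler_norml => xa; rewrite /= !in_itv/= xa; split => // _.
  by apply: le_lt_trans ac; case/andP: xa.
rewrite (@integral_itv_bndo_bndc _ _ _ (EFin \o density s))/=; last first.
  by apply/measurable_EFinP; apply: measurable_funTS; exact: measurable_density.
apply: integral_density_eq => //.
move=> x; rewrite ler_norml => /andP[xa _]; rewrite /= !in_itv/= xa; split => //.
Qed.

Let equilibrium_setT : equilibrium s1 [set: _] = 1%:E.
Proof.
have a0 := endpoint_gt0 s1.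
rewrite /equilibrium (@integral_density_eq _ `[- a, a]%classic)//.
  rewrite integral_density//; last by apply/andP; split; lra.
  rewrite /equilibrium_cdf stretch_endpoint// arcsine_cdf_endpoint//.
  by congr EFin; ring.
by move=> x; rewrite ler_norml /= in_itv.
Qed.

HB.instance Definition _ := @Measure_isProbability.Build _ _ R
  (equilibrium s1) equilibrium_setT.

Lemma unif_arcsine (c : R) : unif ([set u | a * cos (pi * u) < c] : set RT)
  = (arcsine_cdf s (clamp c))%:E.
Proof.
have a0 := endpoint_gt0 s1; have pi0 := pi_gt0 R.
have mA : measurable ([set u | a * cos (pi * u) < c] : set RT).
  apply: (@measurable_lt _ (fun u => a * cos (pi * u))).
  by apply: measurable_funM => //; exact: measurable_cos_pi.
have lo u : - a <= a * cos (pi * u) by have := cos_geN1 (pi * u); nra.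
have hi u : a * cos (pi * u) <= a by have := cos_le1 (pi * u); nra.
rewrite /clamp; have [ca|ca] := ltP c (- a).
  rewrite arcsine_cdfN_endpoint// (_ : [set u | _] = set0) ?measure0//.
  apply/seteqP; split => u //= uc.
  by have := lt_trans (le_lt_trans (lo u) uc) ca; rewrite ltxx.
have [ac|ac] := ltP a c.
  rewrite arcsine_cdf_endpoint// (_ : [set u | _] = setT) ?probability_setT//.
  by apply/seteqP; split => u //= _; exact: le_lt_trans (hi u) ac.
have ca1 : -1 <= c / a <= 1 by rewrite endpoint_itv// ler_norml ca.
have A0 := acos_ge0 ca1; have A1 := acos_lepi ca1.
rewrite (@unif_setC_itv _ _ 0 (acos (c / a) / pi))//.
- by rewrite subr0.
- by rewrite divr_ge0// ltW.
- by rewrite ler_pdivrMr// mul1r.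
- move=> u /andP[u0 u1] /=; rewrite u0/=.
  have -> : (a * cos (pi * u) < c) = (acos (c / a) / pi < u).
    rewrite mulrC -ltr_pdivlMr// -[in LHS](acosK (x := c / a)) ?in_itv//=.
    rewrite ltr_cos ?in_itv/= ?A0//; last by apply/andP; split; nra.
    by rewrite ltr_pdivrMr// [u * _]mulrC.
  by rewrite ltNge; split => /negP.
Qed.

Definition arcsine_law_map (u : R) : R := a * cos (pi * u).

Definition balayage_law_map (u : R) : R := unstretch s (a * cos (pi * u)).

Lemma measurable_arcsine_law_map : measurable_fun [set: RT] arcsine_law_map.
Proof. by apply: measurable_funM => //; exact: measurable_cos_pi. Qed.

Lemma normr_arcsine_law_map (u : R) : `|arcsine_law_map u| <= a.
Proof.
have a0 := endpoint_gt0 s1.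
rewrite /arcsine_law_map normrM (ger0_norm (ltW a0)) ler_piMr ?(ltW a0)//.
by rewrite ler_norml cos_geN1 cos_le1.
Qed.

Lemma slopeB_gt0 (w : R) : `|w| <= a -> 0 < b ^+ 2 - w ^+ 2.
Proof.
move=> wa; have a0 := endpoint_gt0 s1; rewrite sqr_slope// -[w ^+ 2]real_normK ?num_real//.
have : `|w| ^+ 2 <= a ^+ 2 by rewrite ler_sqr ?nnegrE// ltW.
lra.
Qed.

Lemma unstretchK (w : R) : `|w| <= a -> stretch s (unstretch s w) = w.
Proof.
move=> wa; have w0 := slopeB_gt0 wa; have b0 := slope_gt0 s1.
have r0 : 0 < Num.sqrt (b ^+ 2 - w ^+ 2) by rewrite sqrtr_gt0.
rewrite /stretch /unstretch (expr_div_n w) sqr_sqrtr ?(ltW w0)//.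
have -> : 1 + w ^+ 2 / (b ^+ 2 - w ^+ 2) = (b / Num.sqrt (b ^+ 2 - w ^+ 2)) ^+ 2.
  rewrite [RHS]expr_div_n sqr_sqrtr ?(ltW w0)//.
  by move: w0; set B := slope s => w0; field; rewrite gt_eqF.
rewrite sqrtr_sqr ger0_norm; last by apply: divr_ge0; exact: ltW.
move: b0 r0; set B := slope s; set r := Num.sqrt _ => b0 r0.
by field; rewrite !gt_eqF.
Qed.

Lemma balayage_law_map_lt (u c : R) :
  (balayage_law_map u < c) = (arcsine_law_map u < stretch s c).
Proof.
by rewrite -(ltr_stretch s1) unstretchK// normr_arcsine_law_map.
Qed.

Lemma stretch_clamp (c : R) : clamp (stretch s c) = stretch s (clamp c).
Proof.
have E (x y : R) := ltr_stretch s1 x y.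
have E1 : (stretch s c < - a) = (c < - a).
  by rewrite -{1}(stretch_endpoint s1) -stretchN E.
have E2 : (a < stretch s c) = (a < c) by rewrite -{1}(stretch_endpoint s1) E.
rewrite /clamp E1 E2.
by case: ifP => [_|_]; [|case: ifP => _]; rewrite ?stretchN ?stretch_endpoint.
Qed.

Lemma measurable_balayage_law_map : measurable_fun [set: RT] balayage_law_map.
Proof.
have b0 := slope_gt0 s1.
apply: measurable_funM; first exact: measurable_arcsine_law_map.
apply: continuous_measurable_fun => u; apply: cvgV.
  by rewrite gt_eqF// sqrtr_gt0; apply: slopeB_gt0; exact: normr_arcsine_law_map.
apply: (@continuous_comp _ _ _ (fun u => b ^+ 2 - (a * cos (pi * u)) ^+ 2) Num.sqrt).
  apply: cvgB; first exact: cvg_cst.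
  apply: (@continuous_comp _ _ _ (fun u => a * cos (pi * u)) (fun x => x ^+ 2)).
    apply: cvgMr; apply: (@continuous_comp _ _ _ (fun u : R => pi * u) cos).
      by apply: cvgMr; exact: cvg_id.
    exact: continuous_cos.
  exact: exprn_continuous.
exact: sqrt_continuous.
Qed.

(** The equilibrium measure as the signed combination [s beta - (s - 1) omega]
    of the balayage [beta] of the point [i] onto the interval and its arcsine
    law [omega]. *)
Lemma ge0_integral_equilibrium (f : RT -> \bar R) :
  measurable_fun [set: RT] f -> (forall x, 0 <= f x)%E ->
  (\int[equilibrium s1]_x f x + (s - 1)%:E * \int[unif]_u f (arcsine_law_map u)
   = s%:E * \int[unif]_u f (balayage_law_map u))%E.
Proof.
move=> mf f0.
have s0 : 0 <= s by have := s1; lra.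
have s10 : 0 <= s - 1 by have := s1; lra.
pose om : probability RT R := distribution unif (mfun_pack measurable_arcsine_law_map).
pose be : probability RT R := distribution unif (mfun_pack measurable_balayage_law_map).
pose m1 : {measure set RT -> \bar R} := measure_add (equilibrium s1) (mscale (NngNum s10) om).
pose m2 : {measure set RT -> \bar R} := mscale (NngNum s0) be.
have omr c : om `]-oo, c[%classic = (arcsine_cdf s (clamp c))%:E.
  by rewrite -unif_arcsine.
have ber c : be `]-oo, c[%classic = (arcsine_cdf s (stretch s (clamp c)))%:E.
  rewrite -stretch_clamp -unif_arcsine.
  rewrite [in RHS](_ : [set u | _] = balayage_law_map @^-1` `]-oo, c[%classic)//.
  by apply/seteqP; split => u /=; rewrite in_itv/= balayage_law_map_lt.
have m12 : forall A : set RT, measurable A -> m1 A = m2 A.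
  have m1E c : m1 `]-oo, c[%classic = (s * arcsine_cdf s (stretch s (clamp c)))%:E.
    have -> : m1 `]-oo, c[%classic =
      (equilibrium s1 `]-oo, c[%classic + (s - 1)%:E * om `]-oo, c[%classic)%E.
      exact: measure_addE.
    rewrite equilibrium_ray omr -EFinM -EFinD.
    by congr EFin; rewrite /equilibrium_cdf; ring.
  apply: eq_measure_rays => c; last by rewrite m1E ltry.
  have -> : m2 `]-oo, c[%classic = (s%:E * be `]-oo, c[%classic)%E by [].
  by rewrite m1E ber -EFinM.
transitivity (\int[m1]_x f x)%E.
  rewrite (ge0_integral_measure_add _ _ measurableT (fun x _ => f0 x) mf).
  rewrite (ge0_integral_mscale om measurableT (NngNum s10) mf (fun x _ => f0 x)).
  by rewrite (ge0_integral_distribution _ mf f0).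
rewrite (@eq_measure_integral _ _ _ _ m2); last by move=> A mA _; exact: m12.
rewrite (ge0_integral_mscale be measurableT (NngNum s0) mf (fun x _ => f0 x)).
by rewrite (ge0_integral_distribution _ mf f0).
Qed.

End equilibrium_measure.

(** * Integrals of the kernel against the two laws *)

Lemma ge0_integral_unif_sym (R : realType) (f : measurableTypeR R -> \bar R) :
  measurable_fun [set: measurableTypeR R] f -> (forall u, 0 <= f u)%E ->
  (\int[unif]_u f u + \int[unif]_u f u = \int[unif]_u (f u + f (1 - u)%R))%E.
Proof.
move=> mf f0; rewrite [RHS]ge0_integralD//.
  by congr (_ + _)%E; exact: (ge0_integral_transport transports_flip mf f0).
by apply: (measurableT_comp mf); exact: measurable_funB.
Qed.

Section kernel_potentials.
Context {R : realType} (s : R) (s1 : 1 < s).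
Local Notation RT := (measurableTypeR R).
Local Notation a := (endpoint s).
Local Notation b := (slope s).

Lemma integral_ae_EFin (N : set RT) (f : RT -> \bar R) (g : RT -> R) :
  measurable N -> unif N = 0%E -> measurable_fun [set: RT] f ->
  unif.-integrable [set: RT] (EFin \o g) -> (forall u, ~ N u -> f u = (g u)%:E) ->
  (\int[unif]_u f u = (\int[unif]_u g u)%R%:E)%E.
Proof.
move=> mN N0 mf gi fg.
rewrite /Rintegral fineK; last exact: integrable_fin_num.
apply: ae_eq_integral => //; first by have /integrableP[] := gi.
exists N; split => // u /= nfg; apply: contrapT => /fg h.
by apply: nfg => _; rewrite h.
Qed.

Lemma measurable_energy_kernel (x : R) :
  measurable_fun [set: RT] (fun t => energy_kernel (weight s) x t).
Proof.
under eq_fun do rewrite energy_kernel_series.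
apply: emeasurable_funD.
  apply/measurable_EFinP; apply: measurable_funD => //.
  exact: measurable_confinement.
apply: ge0_emeasurable_sum => // [n t _ _|n _].
  by rewrite lee_fin mulr_ge0 ?divr_ge0 ?exprn_ge0 ?proximity_ge0.
apply/measurable_EFinP/measurable_funM => //; apply: measurable_funM => //.
exact: measurable_proximityX.
Qed.

Lemma ln_arcsine (y u : R) : y != arcsine_law_map s u ->
  ln `|y - arcsine_law_map s u| = ln (a / 2) + cheb_kernel (2 * y / a) u.
Proof.
have a0 := endpoint_gt0 s1; rewrite /arcsine_law_map /cheb_kernel => yu.
have E : y - a * cos (pi * u) = a / 2 * (2 * y / a - 2 * cos (pi * u)).
  by move: a0; generalize (endpoint s) (cos (pi * u)) => A C A0; field; rewrite gt_eqF.
have a20 : 0 < a / 2 by rewrite divr_gt0.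
have n0 : 0 < `|2 * y / a - 2 * cos (pi * u)|.
  rewrite normr_gt0; apply: contra yu => /eqP h.
  by rewrite -subr_eq0 E h mulr0.
by rewrite E normrM (gtr0_norm a20) [LHS]lnM ?posrE.
Qed.

Lemma arcsine_law_map_flip (u : R) : arcsine_law_map s (1 - u) = - arcsine_law_map s u.
Proof.
by rewrite /arcsine_law_map mulrBr mulr1 cosB cospi sinpi mul0r addr0 mulN1r mulrN.
Qed.

Lemma ln_arcsineN (y u : R) : y != - arcsine_law_map s u ->
  ln `|y + arcsine_law_map s u| = ln (a / 2) + cheb_kernel (2 * y / a) (1 - u).
Proof.
by rewrite -arcsine_law_map_flip => h; rewrite -ln_arcsine// arcsine_law_map_flip opprK.
Qed.

Definition arcsine_null (y : R) : set RT := [set u | 2 * y / a = 2 * cos (pi * u)].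

Lemma arcsine_nullN (y u : R) : ~ arcsine_null y u -> y != arcsine_law_map s u.
Proof.
have a0 := endpoint_gt0 s1; move=> h; apply/eqP => yu; apply: h.
rewrite /arcsine_null /= yu /arcsine_law_map.
by move: a0; generalize (endpoint s) (cos (pi * u)) => A C A0; field; rewrite gt_eqF.
Qed.

(** The integral of [ln |p - x|] for the arcsine law of [[- a, a]], both at
    [p = b] and at the imaginary unit [p = i]. *)
Definition log_slope : R := ln ((1 + b) / 2).

Lemma cheb_potential_slope : ln (a / 2) + cheb_potential (2 * b / a) = log_slope.
Proof.
have a0 := endpoint_gt0 s1; have b1 := slope_gt1 s1; have b2 := sqr_slope s1.
rewrite /log_slope; move: a0 b1 b2; generalize (endpoint s) (slope s) => A B A0 B1 B2.
have v1 : 1 < (B + 1) / A by rewrite ltr_pdivlMr//; nra.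
have -> : 2 * B / A = (B + 1) / A + ((B + 1) / A)^-1.
  have -> : ((B + 1) / A)^-1 = (B - 1) / A.
    have h : (B - 1) * (B + 1) = A ^+ 2 by lra.
    have hh : B - 1 = A ^+ 2 / (B + 1) by rewrite -h mulfK// gt_eqF//; lra.
    by rewrite hh; field; rewrite !gt_eqF//; lra.
  by field; rewrite gt_eqF.
rewrite cheb_potential_out// -lnM ?posrE ?divr_gt0//; last by lra.
by congr ln; field; rewrite gt_eqF.
Qed.

(** The image of [2 b / a] under [y -> y ^ 2 - 2]. *)
Definition double_slope : R := 4 / a ^+ 2 + 2.

Lemma cheb_potential_double_slope :
  ln (a ^+ 2 / 4) + cheb_potential double_slope = 2 * log_slope.
Proof.
have a0 := endpoint_gt0 s1; have b1 := slope_gt1 s1; have b2 := sqr_slope s1.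
have -> : double_slope = (2 * b / a) ^+ 2 - 2.
  rewrite /double_slope; move: a0 b2; generalize (endpoint s) (slope s) => A B A0 B2.
  have -> : (2 * B / A) ^+ 2 = 4 * B ^+ 2 / A ^+ 2 by field; rewrite gt_eqF.
  by rewrite B2; field; rewrite gt_eqF.
rewrite -cheb_potential_double -cheb_potential_slope mulrDr; congr (_ + _).
have a20 : 0 < a / 2 by rewrite divr_gt0.
have -> : 2 * ln (a / 2) = ln ((a / 2) ^+ 2) by rewrite (lnXn 2 a20) mulr2n; ring.
congr ln.
by move: a0; generalize (endpoint s) => A A0; field.
Qed.

(** As a function of the Chebyshev image of [u], [1 + x ^ 2] is affine, with
    root [- double_slope]. *)
Lemma ln_1D_arcsine (u : R) : ln (1 + arcsine_law_map s u ^+ 2) =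
  ln (a ^+ 2 / 4) + cheb_kernel (- double_slope) (tent u).
Proof.
have a0 := endpoint_gt0 s1.
rewrite /cheb_kernel cos_tent /double_slope /arcsine_law_map.
move: a0; generalize (endpoint s) (cos (pi * u)) => A C A0.
have -> : - (4 / A ^+ 2 + 2) - ((2 * C) ^+ 2 - 2) = - (4 / A ^+ 2 * (1 + (A * C) ^+ 2)).
  by field; rewrite gt_eqF.
have p0 : 0 < 4 / A ^+ 2 * (1 + (A * C) ^+ 2).
  by rewrite mulr_gt0 ?sqrD1_gt0// divr_gt0// exprn_gt0.
rewrite normrN gtr0_norm// -lnM ?posrE ?divr_gt0 ?exprn_gt0//.
by congr ln; field; rewrite gt_eqF.
Qed.

Let icst (c : R) : unif.-integrable [set: RT] (EFin \o cst c).
Proof. exact: finite_measure_integrable_cst. Qed.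

Let cstE (c : R) : \int[@unif R]_u c = c.
Proof. by rewrite (Rintegral_cst _ _ c)// [X in fine X]probability_setT mulr1. Qed.

Lemma arcsine_kernel_integral (x : R) :
  (\int[unif]_u energy_kernel (weight s) x (arcsine_law_map s u) =
   (s / 2 * ln (1 + x ^+ 2) + s * log_slope - ln (a / 2)
     - cheb_potential (2 * x / a))%:E)%E.
Proof.
pose c := s / 2 * ln (1 + x ^+ 2) + s / 2 * ln (a ^+ 2 / 4) - ln (a / 2).
pose g1 (u : R) := cheb_kernel (- double_slope) (tent u).
pose g2 := cheb_kernel (2 * x / a).
have i1 : unif.-integrable [set: RT] (EFin \o g1).
  exact: integrable_transport transports_tent (integrable_cheb_kernel _).
have i2 : unif.-integrable [set: RT] (EFin \o g2) by exact: integrable_cheb_kernel.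
have i1' : unif.-integrable [set: RT] (EFin \o (fun u => s / 2 * g1 u)).
  exact: (integrableZl _ _ i1).
have i3 : unif.-integrable [set: RT] (EFin \o (fun u => c + s / 2 * g1 u)).
  exact: (integrableD _ (icst c) i1').
rewrite (@integral_ae_EFin (arcsine_null x) _ (fun u => c + s / 2 * g1 u - g2 u)).
- congr EFin; rewrite RintegralB// RintegralD//; last exact: icst.
  rewrite cstE RintegralZl//.
  rewrite /g1 -(integral_transport transports_tent (integrable_cheb_kernel _)).
  rewrite -/(cheb_potential _) -/(cheb_potential _) cheb_potentialN.
  have -> : log_slope = (ln (a ^+ 2 / 4) + cheb_potential double_slope) / 2.
    by rewrite cheb_potential_double_slope; field.
  by rewrite /c; field.
- exact: measurable_cheb_null.
- exact: unif_cheb_null.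
- by apply: measurableT_comp (measurable_energy_kernel x) _; exact: measurable_arcsine_law_map.
- exact: (integrableB _ i3 i2).
- move=> u /arcsine_nullN xu; rewrite energy_kernel_neq// ln_arcsine// ln_1D_arcsine.
  by congr EFin; rewrite /c /g1 /g2; ring.
Qed.

(** Adding the kernels at [t] and [- t] replaces [x - t] by
    [x ^ 2 - t ^ 2] in the logarithm, and
    [x ^ 2 - t ^ 2 = (1 + x ^ 2) (y ^ 2 - w ^ 2) / (b ^ 2 - w ^ 2)] with
    [y = stretch x] and [w = stretch t]. *)
Lemma symmetrized_kernel (x u : R) : let w := arcsine_law_map s u in
  stretch s x != w -> stretch s x != - w ->
  (energy_kernel (weight s) x (unstretch s w) +
     energy_kernel (weight s) x (unstretch s (- w)) =
   ((s - 1) * ln (1 + x ^+ 2) + 2 * s * ln b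
     - (ln `|stretch s x - w| + ln `|stretch s x + w|)
     - (s - 1) * (ln `|b - w| + ln `|b + w|))%:E)%E.
Proof.
move=> w xw xw'; have wa : `|w| <= a by exact: normr_arcsine_law_map.
have w'a : `|- w| <= a by rewrite normrN.
have w0 := slopeB_gt0 s1 wa; have b0 := slope_gt0 s1.
set t := unstretch s w.
have tN : unstretch s (- w) = - t by rewrite /t /unstretch sqrrN mulNr.
have xt : x != t by apply: contra xw => /eqP ->; rewrite unstretchK.
have xt' : x != - t.
  by apply: contra xw' => /eqP ->; rewrite -tN unstretchK.
have x0 := sqrD1_gt0 x; have t0 := sqrD1_gt0 t.
have t2 : t ^+ 2 = w ^+ 2 / (b ^+ 2 - w ^+ 2).
  by rewrite /t /unstretch (expr_div_n w) sqr_sqrtr// ltW.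
have y2 := sqr_stretch s x.
rewrite tN !energy_kernel_neq// sqrrN opprK -EFinD; congr EFin.
have xt0 : 0 < `|x - t| by rewrite normr_gt0 subr_eq0.
have xt0' : 0 < `|x + t| by rewrite normr_gt0 -[t]opprK subr_eq0.
have yw0 : 0 < `|stretch s x - w| by rewrite normr_gt0 subr_eq0.
have yw0' : 0 < `|stretch s x + w| by rewrite normr_gt0 -[w]opprK subr_eq0.
have bw : 0 < `|b - w|.
  rewrite normr_gt0 subr_eq0; apply: contraTneq w0 => <-.
  by rewrite subrr ltxx.
have bw' : 0 < `|b + w|.
  rewrite normr_gt0 -[w]opprK subr_eq0; apply: contraTneq w0 => bE.
  by rewrite bE sqrrN subrr ltxx.
have E1 : ln `|x - t| + ln `|x + t| = ln `|stretch s x - w| + ln `|stretch s x + w|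
    + ln (1 + x ^+ 2) - (ln `|b - w| + ln `|b + w|).
  rewrite -!lnM ?posrE ?mulr_gt0// -ln_div ?posrE ?mulr_gt0// -!normrM.
  rewrite -!subr_sqr -[in RHS](gtr0_norm x0) -normrM -normf_div; congr (ln `|_|).
  rewrite y2 t2; move: w0; generalize b w => B W w0.
  by field; rewrite !gt_eqF.
have E2 : ln (1 + t ^+ 2) = 2 * ln b - (ln `|b - w| + ln `|b + w|).
  rewrite -lnM ?posrE// -normrM -subr_sqr gtr0_norm// mulr_natl -(lnXn 2 b0).
  rewrite -ln_div ?posrE ?exprn_gt0//; congr ln; rewrite t2.
  by move: w0; generalize b w => B W w0; field; rewrite gt_eqF.
by rewrite E2; move: E1; lra.
Qed.

Definition sym_cheb_kernel (y u : R) : R := cheb_kernel y u + cheb_kernel y (1 - u).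

Lemma integrable_sym_cheb_kernel (y : R) :
  unif.-integrable [set: RT] (EFin \o sym_cheb_kernel y).
Proof.
have i := integrable_cheb_kernel y.
exact: (integrableD _ i (integrable_transport transports_flip i)).
Qed.

Lemma integral_sym_cheb_kernel (y : R) :
  \int[unif]_u sym_cheb_kernel y u = 2 * cheb_potential y.
Proof.
have i := integrable_cheb_kernel y.
rewrite RintegralD//; last exact: (integrable_transport transports_flip i).
rewrite -(integral_transport transports_flip i).
by rewrite -/(cheb_potential _) mulr_natl mulr2n.
Qed.

Lemma ln_sym_arcsine (y u : R) :
  y != arcsine_law_map s u -> y != - arcsine_law_map s u ->
  ln `|y - arcsine_law_map s u| + ln `|y + arcsine_law_map s u| =
  2 * ln (a / 2) + sym_cheb_kernel (2 * y / a) u.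
Proof.
by move=> h h'; rewrite ln_arcsine// ln_arcsineN// /sym_cheb_kernel; ring.
Qed.

Lemma balayage_kernel_integral (x : R) :
  (\int[unif]_u energy_kernel (weight s) x (balayage_law_map s u) =
   ((s - 1) / 2 * ln (1 + x ^+ 2) + s * ln b - (s - 1) * log_slope - ln (a / 2)
     - cheb_potential (2 * stretch s x / a))%:E)%E.
Proof.
set f := fun u => energy_kernel (weight s) x (balayage_law_map s u).
have mf : measurable_fun [set: RT] f.
  apply: measurableT_comp (measurable_energy_kernel x) _.
  exact: measurable_balayage_law_map.
have f0 u : (0 <= f u)%E by exact: energy_kernel_ge0.
have mflip : measurable_fun [set: RT] (fun u : RT => 1 - u) by exact: measurable_funB.
pose c := (s - 1) * ln (1 + x ^+ 2) + 2 * s * ln b - 2 * s * ln (a / 2).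
pose g1 := sym_cheb_kernel (2 * stretch s x / a).
pose g2 := sym_cheb_kernel (2 * b / a).
have i1 : unif.-integrable [set: RT] (EFin \o g1) by exact: integrable_sym_cheb_kernel.
have i2 : unif.-integrable [set: RT] (EFin \o g2) by exact: integrable_sym_cheb_kernel.
have i2' : unif.-integrable [set: RT] (EFin \o (fun u => (s - 1) * g2 u)).
  exact: (integrableZl _ _ i2).
have i3 : unif.-integrable [set: RT] (EFin \o (fun u => c - g1 u)).
  exact: (integrableB _ (icst c) i1).
have : (\int[unif]_u f u + \int[unif]_u f u =
    (c - 2 * cheb_potential (2 * stretch s x / a)
       - (s - 1) * (2 * cheb_potential (2 * b / a)))%:E)%E.
  rewrite (ge0_integral_unif_sym mf f0).
  rewrite (@integral_ae_EFin (arcsine_null (stretch s x) `|` arcsine_null (- stretch s x))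
    _ (fun u => c - g1 u - (s - 1) * g2 u)).
  - congr EFin; rewrite RintegralB// RintegralB//; last exact: icst.
    by rewrite cstE RintegralZl// !integral_sym_cheb_kernel.
  - by apply: measurableU; exact: measurable_cheb_null.
  - apply/eqP; rewrite -measure_le0; apply: le_trans (measureU2 _ _ _) _.
    + exact: measurable_cheb_null.
    + exact: measurable_cheb_null.
    + have e0 y : (unif (arcsine_null y) <= 0)%E by rewrite unif_cheb_null.
      by rewrite -[leRHS]adde0; apply: leeD; exact: e0.
  - exact: (emeasurable_funD mf (measurableT_comp mf mflip)).
  - exact: (integrableB _ i3 i2').
  move=> u /not_orP[/arcsine_nullN xu /arcsine_nullN xu'].
  rewrite eqr_oppLR in xu'.
  have wa := normr_arcsine_law_map s1 u.
  have ab : a < b.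
    rewrite -ltr_sqr ?nnegrE ?(ltW (endpoint_gt0 s1)) ?(ltW (slope_gt0 s1))//.
    by rewrite sqr_slope// ltrDr.
  have bw : b != arcsine_law_map s u.
    by rewrite gt_eqF// (le_lt_trans _ ab)// (le_trans (ler_norm _) wa).
  have bw' : b != - arcsine_law_map s u.
    by rewrite gt_eqF// (le_lt_trans _ ab)// (le_trans (ler_norm _))// normrN.
  rewrite /f /balayage_law_map -/(arcsine_law_map s u) -/(arcsine_law_map s (1 - u)).
  rewrite arcsine_law_map_flip symmetrized_kernel// !ln_sym_arcsine//.
  by congr EFin; rewrite /c /g1 /g2; ring.
have -> : cheb_potential (2 * b / a) = log_slope - ln (a / 2).
  by rewrite -cheb_potential_slope; ring.
case: (\int[unif]_u f u)%E => [r| |]//= [rr].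
by congr EFin; rewrite /c in rr; lra.
Qed.

End kernel_potentials.

(** * The potential of the equilibrium measure *)

(** [b artanh t <= artanh (b t)]: both sides vanish at [t = 0], and the
    derivatives are [b / (1 - t ^ 2)] and [b / (1 - (b t) ^ 2)]. *)
Lemma artanh_superlinear (R : realType) (b t : R) : 1 <= b -> 0 <= t -> b * t < 1 ->
  b * (ln (1 + t) - ln (1 - t)) <= ln (1 + b * t) - ln (1 - b * t).
Proof.
move=> b1 t0 bt1.
pose f (c y : R) := ln (1 + c * y) - ln (1 - c * y).
pose df (c y : R) := c / (1 + c * y) + c / (1 - c * y).
have dlin (c y k : R) : is_derive y 1 (fun z : R => k + c * z) c.
  have := is_deriveD (is_derive_cst k y 1) (is_deriveZ c (is_derive_id y (1 : R))).
  by rewrite add0r scaler1.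
have fdf (c y : R) : 0 < 1 + c * y -> 0 < 1 - c * y -> is_derive y 1 (f c) (df c y).
  move=> p q.
  have h1 := @is_derive1_comp R (@ln R) (fun z => 1 + c * z) y _ _
    (is_derive1_ln p) (dlin c y 1).
  have q' : 0 < 1 + (- c) * y by rewrite mulNr.
  have h2 := @is_derive1_comp R (@ln R) (fun z => 1 + (- c) * z) y _ _
    (is_derive1_ln q') (dlin (- c) y 1).
  have := is_deriveB h1 h2.
  rewrite (_ : _ - _ = f c); last by apply/funext => z; rewrite /f -mulNr.
  by rewrite (_ : _ - _ = df c y)// /df mulNr mulrN opprK [c / _]mulrC [c / (1 - _)]mulrC.
have dom (y : R) : y \in `[0, t] -> [/\ 0 < 1 + b * y, 0 < 1 - b * y, 0 < 1 + 1 * y & 0 < 1 - 1 * y].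
  rewrite in_itv/= => /andP[y0 yt].
  have : b * y <= b * t by rewrite ler_wpM2l//; lra.
  have : 0 <= b * y by rewrite mulr_ge0//; lra.
  have : y <= b * y by rewrite ler_peMl.
  by rewrite mul1r => h1 h2 h3; split; lra.
pose g (y : R) := f b y - b * f 1 y.
have dg (y : R) : y \in `[0, t] -> is_derive y 1 g (df b y - b * df 1 y).
  move=> /dom[p1 p2 p3 p4].
  exact: (is_deriveB (fdf b y p1 p2) (is_deriveZ b (fdf 1 y p3 p4))).
have g_derive (y : R) : y \in `]0, t[ -> is_derive y 1 g (df b y - b * df 1 y).
  by move=> yt; apply: dg; exact: subset_itv_oo_cc.
have g_cont : {within `[0, t], continuous g}.
  by apply: derivable_within_continuous => y /dg [].
have [c ct E] := MVT_segment t0 g_derive g_cont.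
have g0 : g 0 = 0 by rewrite /g /f !mulr0 !addr0 !subr0 ln1; ring.
rewrite g0 !subr0 in E.
suff : 0 <= g t by rewrite /g /f !mul1r subr_ge0.
rewrite E mulr_ge0//; have [p1 p2 p3 p4] := dom c ct.
have -> : df b c - b * df 1 c =
  2 * b * (c ^+ 2 * (b ^+ 2 - 1)) / ((1 + b * c) * (1 - b * c) * ((1 + 1 * c) * (1 - 1 * c))).
  by rewrite /df; field; rewrite !mul1r in p3 p4 *; rewrite !gt_eqF.
apply: divr_ge0; last by rewrite !mulr_ge0// ltW.
have b2 : 0 <= b ^+ 2 - 1 by nra.
apply: mulr_ge0; first by lra.
by apply: mulr_ge0; first exact: sqr_ge0.
Qed.

Section equilibrium_potential.
Context {R : realType} (s : R) (s1 : 1 < s).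
Local Notation RT := (measurableTypeR R).
Local Notation a := (endpoint s).
Local Notation b := (slope s).
Local Notation eqm := (equilibrium s1 : probability RT R).

(** The modified Robin constant, which is the minimal energy. *)
Definition robin : R := s ^+ 2 * ln b - 2 * s * (s - 1) * log_slope s - ln (a / 2).

Lemma equilibrium_potentialE (x : R) :
  (\int[eqm]_t energy_kernel (weight s) x t = (robin
    + ((s - 1) * cheb_potential (2 * x / a)
       - s * cheb_potential (2 * stretch s x / a)))%:E)%E.
Proof.
have := ge0_integral_equilibrium s1 (measurable_energy_kernel s x)
  (fun t => energy_kernel_ge0 x t s1).
rewrite arcsine_kernel_integral// balayage_kernel_integral// -!EFinM.
case: (\int[_]_t _)%E => [r| |]//= [rr].
congr EFin; move: rr; rewrite /robin => rr.
have -> : r = s * ((s - 1) / 2 * ln (1 + x ^+ 2) + s * ln b - (s - 1) * log_slope s -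
    ln (a / 2) - cheb_potential (2 * stretch s x / a))
  - (s - 1) * (s / 2 * ln (1 + x ^+ 2) + s * log_slope s - ln (a / 2) -
    cheb_potential (2 * x / a)).
  by rewrite -rr; ring.
by field.
Qed.

Lemma cheb_potential_support (x : R) : `|x| <= a -> cheb_potential (2 * x / a) = 0.
Proof.
move=> xa; apply: cheb_potential_in; have a0 := endpoint_gt0 s1.
by rewrite normrM normfV (gtr0_norm a0) normrM ger0_norm// ler_pdivrMr//; lra.
Qed.

(** Outside the support: [2 x / a = v + 1 / v] with [ln v = artanh h]. *)
Lemma cheb_potential_artanh (x : R) : a < x -> let h := Num.sqrt (x ^+ 2 - a ^+ 2) / x in
  cheb_potential (2 * x / a) = (ln (1 + h) - ln (1 - h)) / 2.
Proof.
move=> ax; have a0 := endpoint_gt0 s1; have x0 : 0 < x by exact: lt_trans ax.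
have xa2 : 0 < x ^+ 2 - a ^+ 2 by rewrite subr_gt0 ltr_sqr ?nnegrE ?ltW.
have q0 : 0 < Num.sqrt (x ^+ 2 - a ^+ 2) by rewrite sqrtr_gt0.
have q2 := sqr_sqrtr (ltW xa2).
move: a0 ax q0 q2; rewrite /=; set q := Num.sqrt _; generalize (endpoint s) => A A0 Ax q0 q2.
have qx : q < x.
  by rewrite -ltr_sqr ?nnegrE ?(ltW q0) ?(ltW x0)// q2 ltrBlDr ltrDl exprn_gt0.
have v1 : 1 < (x + q) / A by rewrite ltr_pdivlMr//; lra.
have v0 : 0 < (x + q) / A by exact: lt_trans v1.
have vi : ((x + q) / A)^-1 = (x - q) / A.
  apply: (mulfI (lt0r_neq0 v0)); rewrite mulfV ?gt_eqF//.
  have -> : (x + q) / A * ((x - q) / A) = (x ^+ 2 - q ^+ 2) / A ^+ 2 by field; rewrite gt_eqF.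
  by rewrite q2 opprB addrCA subrr addr0 mulfV// expf_neq0 ?gt_eqF.
have -> : 2 * x / A = (x + q) / A + ((x + q) / A)^-1 by rewrite vi; field; rewrite gt_eqF.
rewrite cheb_potential_out//.
have h1 : 0 < 1 + q / x by rewrite addr_gt0// divr_gt0.
have h2 : 0 < 1 - q / x by rewrite subr_gt0 ltr_pdivrMr// mul1r.
rewrite -ln_div ?posrE//.
have -> : (1 + q / x) / (1 - q / x) = ((x + q) / A) ^+ 2.
  have -> : (1 + q / x) / (1 - q / x) = (x + q) / (x - q).
    by field; rewrite !gt_eqF ?subr_gt0.
  have -> : x - q = A / ((x + q) / A).
    by rewrite vi mulrC divfK// gt_eqF.
  by field; rewrite !gt_eqF//; lra.
by rewrite (lnXn 2 v0) mulr2n; field.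
Qed.

(** In the coordinates of [cheb_potential_artanh] the map [stretch] divides [h]
    by the slope [b], while [s = (s - 1) b]. *)
Lemma cheb_potential_stretch_le (x : R) :
  s * cheb_potential (2 * stretch s x / a) <= (s - 1) * cheb_potential (2 * x / a).
Proof.
have a0 := endpoint_gt0 s1; have b1 := slope_gt1 s1; have b0 := slope_gt0 s1.
have c0 := sB1_gt0 s1.
have [xa|xa] := leP `|x| a.
  rewrite !cheb_potential_support// ?normr_stretch_le//; lra.
wlog x0 : x xa / 0 < x.
  have [x0|x0] := ltP 0 x; first exact.
  move=> /(_ (- x)); rewrite normrN => /(_ xa); rewrite stretchN !mulrN !mulNr !cheb_potentialN.
  apply; rewrite oppr_gt0 lt_neqAle x0 andbT; apply: contraTneq xa => ->.
  by rewrite normr0 -leNgt ltW.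
rewrite gtr0_norm// in xa.
have ta : a < stretch s x by rewrite -{1}(stretch_endpoint s1) ltr_stretch.
rewrite !cheb_potential_artanh//=.
set h := Num.sqrt (x ^+ 2 - a ^+ 2) / x.
have r0 := sqrt_sqrD1_gt0 x.
have -> : Num.sqrt (stretch s x ^+ 2 - a ^+ 2) / stretch s x = h / b.
  have -> : stretch s x ^+ 2 - a ^+ 2 = (x ^+ 2 - a ^+ 2) / (1 + x ^+ 2).
    by rewrite -opprB endpointB_stretch// -mulNr opprB.
  rewrite sqrtrM; last by rewrite subr_ge0 ler_sqr ?nnegrE ltW.
  rewrite sqrtrV ?(ltW (sqrD1_gt0 x))// /stretch /h.
  move: b0 r0; generalize (slope s) (Num.sqrt (1 + x ^+ 2)) => B r B0 r0.
  by field; rewrite !gt_eqF.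
have h0 : 0 <= h by rewrite divr_ge0 ?sqrtr_ge0 ?ltW.
have h1 : h < 1.
  rewrite /h ltr_pdivrMr// mul1r -ltr_sqr ?nnegrE ?sqrtr_ge0 ?(ltW x0)//.
  rewrite sqr_sqrtr ?ltrBlDr ?ltrDl ?exprn_gt0//.
  by rewrite subr_ge0 ler_sqr ?nnegrE ltW.
have bh : b * (h / b) = h by rewrite mulrC divfK// gt_eqF.
have := @artanh_superlinear R b (h / b) (ltW b1).
rewrite divr_ge0 ?(ltW b0)// bh => /(_ isT h1) H.
have sE y : s * y = (s - 1) * (b * y) by rewrite mulrA -(slopeE s1).
by rewrite sE ler_pM2l//; lra.
Qed.

Lemma equilibrium_potential_ge (x : R) :
  (robin%:E <= \int[eqm]_t energy_kernel (weight s) x t)%E.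
Proof.
by rewrite equilibrium_potentialE lee_fin lerDl subr_ge0 cheb_potential_stretch_le.
Qed.

Lemma equilibrium_potential_support (x : R) : `|x| <= a ->
  (\int[eqm]_t energy_kernel (weight s) x t = robin%:E)%E.
Proof.
move=> xa; rewrite equilibrium_potentialE !cheb_potential_support//.
  by rewrite !mulr0 subrr addr0.
by rewrite normr_stretch_le.
Qed.

End equilibrium_potential.

(** * Minimality, support and capacity *)

Section minimality.
Context {R : realType} (s : R) (s1 : 1 < s).
Local Notation RT := (measurableTypeR R).
Local Notation a := (endpoint s).
Local Notation b := (slope s).
Local Notation eqm := (equilibrium s1 : probability RT R).
Implicit Types mu : probability RT R.

Lemma measurable_integral_kernel mu :
  measurable_fun [set: RT] (fun z => \int[mu]_t energy_kernel (weight s) z t)%E.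
Proof.
under eq_fun do rewrite integral_energy_kernel//.
apply: emeasurable_funD.
  apply: emeasurable_funD; last exact: measurable_cst.
  by apply/measurable_EFinP; exact: measurable_confinement.
apply: ge0_emeasurable_sum => [n z _ _|n _].
  rewrite lee_fin mulr_ge0 ?divr_ge0// -lee_fin -integral_proximityX.
  by apply: integral_ge0 => t _; rewrite lee_fin exprn_ge0// proximity_ge0.
apply/measurable_EFinP; apply: measurable_funM => //; apply: measurable_sum => j.
by apply: measurable_funM => //; exact: measurable_moment_fun.
Qed.

Lemma robin_ge0 : 0 <= robin s.
Proof.
rewrite -lee_fin -(@equilibrium_potential_support _ _ s1 0).
  by apply: integral_ge0 => t _; exact: energy_kernel_ge0.
by rewrite normr0 ltW// endpoint_gt0.
Qed.

Lemma mutual_energy_equilibrium_ge mu : ((robin s)%:E <= mutual_energy s mu eqm)%E.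
Proof.
rewrite -[leLHS]mule1 -(probability_setT mu) -integral_cst// /mutual_energy.
apply: ge0_le_integral => //.
- by move=> z _; rewrite lee_fin robin_ge0.
- exact: measurable_integral_kernel.
- by move=> z _; exact: equilibrium_potential_ge.
Qed.

Lemma energy_equilibrium : mutual_energy s eqm eqm = (robin s)%:E.
Proof.
rewrite -[RHS]mule1 -(probability_setT eqm) -integral_cst// /mutual_energy.
apply: ae_eq_integral => //; first exact: measurable_integral_kernel.
have mN : measurable (~` `[(- a)%R, a]%classic : set RT).
  by apply: measurableC; exact: measurable_itv.
exists (~` `[(- a)%R, a]%classic); split => //.
  rewrite [LHS](@integral_density_eq _ _ s1 _ set0)// ?integral_set0//.
  by move=> x; rewrite ler_norml /= in_itv.
move=> x /=; rewrite in_itv/= -ler_norml => h xa; apply: h => _.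
exact: equilibrium_potential_support.
Qed.

Definition moment_gap mu : \bar R :=
  (\sum_(0 <= n <oo) (2^-1 / n.+1%:R * moment_dist mu eqm n.+1)%R%:E)%E.

Lemma moment_gap_ge0 mu : (0 <= moment_gap mu)%E.
Proof.
apply: nneseries_ge0 => n _ _.
by rewrite lee_fin mulr_ge0 ?divr_ge0 ?moment_dist_ge0.
Qed.

(** [energy_identity] with the equilibrium measure as second argument: the mixed
    term is at least [robin] because the potential is. *)
Lemma energy_ge mu : ((robin s)%:E + moment_gap mu <= mutual_energy s mu mu)%E.
Proof.
rewrite -(@leeD2rE _ (robin s)%:E)// -[X in (_ <= _ + X)%E]energy_equilibrium.
rewrite (energy_identity s1) -/(moment_gap mu) addeAC leeD2r//.
by apply: leeD; exact: mutual_energy_equilibrium_ge.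
Qed.

Lemma min_energyE : min_energy (weight s) = (robin s)%:E.
Proof.
apply/eqP; rewrite eq_le; apply/andP; split.
  by apply: ereal_inf_lbound; exists eqm => //; exact: energy_equilibrium.
apply: le_ereal_inf_tmp => _ [mu _ <-].
by apply: le_trans (energy_ge mu); rewrite leeDl// moment_gap_ge0.
Qed.

Lemma equilibrium_is_equilibrium : is_equilibrium_measure (weight s) eqm.
Proof. by rewrite /is_equilibrium_measure min_energyE; exact: energy_equilibrium. Qed.

Lemma equilibrium_unique mu : is_equilibrium_measure (weight s) mu ->
  forall A : set RT, measurable A -> mu A = eqm A.
Proof.
rewrite /is_equilibrium_measure min_energyE => muE.
have gap0 : (moment_gap mu <= 0)%E.
  have := energy_ge mu; rewrite [X in (_ <= X)%E]muE -[X in (_ <= X)%E]adde0.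
  by rewrite leeD2lE.
apply: moments_determine => n j jn; apply: moment_dist_eq0 jn _.
have d0 := moment_dist_ge0 mu eqm n.+1.
apply/eqP; rewrite eq_le d0 andbT.
have c0 : 0 < 2^-1 / n.+1%:R :> R by rewrite divr_gt0.
rewrite -(pmulr_rle0 _ c0) -lee_fin; apply: le_trans gap0.
apply: le_trans (nneseries_lim_ge n.+1 _); last first.
  by move=> k _ _; rewrite lee_fin mulr_ge0 ?divr_ge0 ?moment_dist_ge0.
rewrite big_nat_recr//= leeDr// sume_ge0// => k _.
by rewrite lee_fin mulr_ge0 ?divr_ge0 ?moment_dist_ge0.
Qed.

Lemma density_gt0 (x : R) : `|x| < a -> 0 < density s x.
Proof.
move=> xa; have a0 := endpoint_gt0 s1; have c0 := sB1_gt0 s1.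
rewrite densityE//; apply: divr_gt0; last by rewrite mulr_gt0 ?pi_gt0 ?sqrD1_gt0.
rewrite mulr_gt0 ?(mulr_gt0 c0)// sqrtr_gt0.
by move: xa; rewrite -endpoint_itvo// => /andP[h1 h2]; nra.
Qed.

(** Otherwise the density, which is positive on the interval, would vanish
    almost everywhere on it. *)
Lemma equilibrium_itv_gt0 (c d : R) : c < d -> - a < c -> d < a ->
  (0 < eqm `[c, d]%classic)%E.
Proof.
move=> cd ac da; rewrite lt0e measure_ge0 andbT; apply/negP => /eqP E.
have : (\int[lebesgue_measure]_(x in `[c, d]) `|(density s x)%:E| = 0)%E.
  rewrite -[RHS]E; apply: eq_integral => x _.
  by rewrite gee0_abs// lee_fin density_ge0.
move/ae_eq_integral_abs => /(_ (measurable_itv _)) []//.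
  by apply/measurable_EFinP; apply: measurable_funTS; exact: measurable_density.
move=> N [mN N0 HN].
have : (lebesgue_measure (`[c, d]%classic : set RT) <= 0)%E.
  rewrite -N0; apply: le_measure; rewrite ?inE//.
  move=> x xcd; apply: HN => /= h; have := h xcd.
  move: xcd; rewrite /= in_itv/= => /andP[cx xd] [d0].
  have : 0 < density s x.
    by apply: density_gt0; rewrite ltr_norml (lt_le_trans ac cx) (le_lt_trans xd da).
  by rewrite d0 ltxx.
by rewrite lebesgue_measure_itv/= lte_fin cd -EFinB lee_fin subr_le0 leNgt cd.
Qed.

Lemma measure_supp_equilibrium : measure_supp eqm = `[- a, a]%classic.
Proof.
have a0 := endpoint_gt0 s1; apply/seteqP; split => x.
  move=> suppx; rewrite /= in_itv/= -ler_norml; apply: contrapT => /negP xa.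
  have oU : open (~` `[- a, a]%classic) by apply: closed_openC; exact: itv_closed.
  have Ux : (~` `[- a, a]%classic) x by rewrite /= in_itv/= -ler_norml; exact/negP.
  have := suppx _ oU Ux; rewrite [X in (_ < X)%E](_ : _ = 0)%E ?ltxx//.
  rewrite [LHS](@integral_density_eq _ _ s1 _ set0)// ?integral_set0//.
    exact: open_measurable.
  by move=> y; rewrite ler_norml /= in_itv.
rewrite /= in_itv/= => /andP[ax xa] U oU Ux.
have /nbhs_ballP[e /= e0] : nbhs x U by exact: open_nbhs_nbhs.
rewrite ball_itv => eU.
have [lo [hi [lohi alo hia xlo xhi]]] : exists lo hi : R,
    [/\ lo < hi, - a <= lo, hi <= a, x - e <= lo & hi <= x + e].
  exists (Num.max (- a) (x - e)), (Num.min a (x + e)).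
  by split; rewrite ?le_max ?ge_min ?lexx ?orbT// gt_max !lt_min; apply/andP; split; apply/andP; split; lra.
pose c := (2 * lo + hi) / 3; pose d := (lo + 2 * hi) / 3.
have cd0 : (0 < eqm `[c, d]%classic)%E.
  by apply: equilibrium_itv_gt0; rewrite /c /d; lra.
apply: lt_le_trans cd0 _; apply: le_measure; rewrite ?inE//.
  exact: open_measurable.
move=> y /=; rewrite in_itv/= => /andP[cy yd]; apply: eU; rewrite /= in_itv/=.
by move: cy yd; rewrite /c /d => cy yd; apply/andP; split; lra.
Qed.

Lemma robin_capacity : expR (- robin s) =
  2 `^ (2 * s - 2 * s ^+ 2 - 1) * s `^ (- s ^+ 2)
    * (s - 1) `^ (- (s - 1) ^+ 2) * (2 * s - 1) `^ ((2 * s - 1) ^+ 2 / 2).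
Proof.
have s0 : 0 < s by have := s1; lra.
have c0 := sB1_gt0 s1.
have d0 : 0 < 2 * s - 1 by have := s1; lra.
rewrite /powR !gt_eqF// -!expRD; congr expR.
have lnb : ln b = ln s - ln (s - 1) by rewrite /slope ln_div.
have lna : ln (a / 2) = ln (2 * s - 1) / 2 - ln (s - 1) - ln 2.
  rewrite /endpoint !ln_div ?posrE ?divr_gt0 ?sqrtr_gt0//.
  by rewrite -powR12_sqrt ?(ltW d0)// ln_powR; field.
have lnl : log_slope s = ln (2 * s - 1) - ln (s - 1) - ln 2.
  rewrite /log_slope /slope.
  have -> : (1 + s / (s - 1)) / 2 = (2 * s - 1) / (s - 1) / 2.
    by field; rewrite gt_eqF.
  by rewrite !ln_div ?posrE ?divr_gt0.
by rewrite /robin lnb lna lnl; field.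
Qed.

End minimality.

Theorem theorem2p1 (R : realType) (s : R) (hs : 1 < s) :
  [/\ exists mu : probability (measurableTypeR R) R,
        is_equilibrium_measure (weight s) mu,
      forall mu : probability (measurableTypeR R) R,
        is_equilibrium_measure (weight s) mu ->
        measure_supp mu = `[- (Num.sqrt (2 * s - 1) / (s - 1)),
                            Num.sqrt (2 * s - 1) / (s - 1)]%classic /\
        (forall A : set (measurableTypeR R), measurable A ->
           mu A = (\int[lebesgue_measure]_(x in A `&` measure_supp mu)
                     (Num.sqrt (2 * s - 1 - (s - 1) ^+ 2 * x ^+ 2)
                        / (pi * (1 + x ^+ 2)))%:E)%E)
    & weighted_capacity (weight s) =
        (2 `^ (2 * s - 2 * s ^+ 2 - 1) * s `^ (- s ^+ 2)
           * (s - 1) `^ (- (s - 1) ^+ 2)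
           * (2 * s - 1) `^ ((2 * s - 1) ^+ 2 / 2))%:E].
Proof.
split.
- by exists (equilibrium hs); exact: equilibrium_is_equilibrium.
- move=> mu mu_eq; have muE := equilibrium_unique hs mu_eq.
  have suppE : measure_supp mu = `[- endpoint s, endpoint s]%classic.
    rewrite -(measure_supp_equilibrium hs); apply/seteqP.
    by split => x xsupp U oU Ux; have := xsupp U oU Ux; rewrite muE//; exact: open_measurable.
  split; first exact: suppE.
  move=> A mA; rewrite suppE muE//.
  apply: (integral_density_eq hs) => //; first by apply: measurableI => //; exact: measurable_itv.
  by move=> x; rewrite ler_norml /= in_itv/= => ->; split => [|[]].
- by rewrite /weighted_capacity (min_energyE hs)/= robin_capacity.
Qed.
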